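(* (Multi-fractal mass transference principle) Let $\mu_\phi$ be the Gibbs measure on $\Sigma_2^+$ associated to a Hölder potential $\phi$, and let $0<c<h_{\mu_\phi}$. Then for $\mu_\phi$-a.e. $x$, $$h_{\rm top}\{y\in\Sigma_2^+:\ \alpha(x,y)\le c\}\ge c.$$
   Context: $(\Sigma_2^+,\sigma)$ is the one-sided full shift on the symbols $0,1$; $C_n(y)=[y_0,\dots,y_{n-1}]$ is the cylinder of length $n$ containing $y$. All logarithms, entropies are to base 2. $\Sigma_2^+$ carries the metric $d(x,y)=2^{-n}$, $n$ being the least index with $x_n\ne y_n$. $\mu_\phi$ is the shift-invariant Gibbs (equilibrium) probability measure of the Hölder potential $\phi$, and $h_{\mu_\phi}$ its metric entropy. $h_{\rm top}$ is the topological entropy of (not necessarily compact) subsets in the sense of Bowen/Pesin, which with base-2 logarithms equals the Hausdorff dimension with respect to $d$. Hitting times: $\tau_n(x,y)=\inf\{l\ge1:\ \sigma^lx\in C_n(y)\}$ and $\alpha(x,y)=\liminf_{n\to\infty}\frac1n\log\tau_n(x,y)$. *)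

(* Defs.v *)
From HB Require Import structures.
From mathcomp Require Import all_boot all_order all_algebra.
From mathcomp Require Import all_classical all_reals all_analysis.

Set Implicit Arguments.
Unset Strict Implicit.
Unset Printing Implicit Defensive.
Import Order.TTheory GRing.Theory Num.Theory.
Import numFieldNormedType.Exports.

Local Open Scope classical_set_scope.
Local Open Scope ring_scope.

(* The product topology on nat -> bool is the topology of the metric [dist]
   below; the sigma-algebra is the Borel one. *)
Definition Sigma2 : Type := cantor_space.
HB.instance Definition _ := Topological.on Sigma2.
HB.instance Definition _ := Pointed.on Sigma2.
HB.instance Definition _ :=
  Measurable.copy Sigma2 (g_sigma_algebraType (@open cantor_space)).

Definition symbol_at (x : Sigma2) (n : nat) : bool := x n.

Definition shift_map (x : Sigma2) : Sigma2 := fun n => symbol_at x n.+1.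

Definition cylinder (n : nat) (y : Sigma2) : set Sigma2 :=
  [set z | forall i : nat, (i < n)%N -> symbol_at z i = symbol_at y i].

Definition dist {R : realType} (x y : Sigma2) : R :=
  match pselect (exists n, symbol_at x n != symbol_at y n) with
  | left h => 2 ^- ex_minn h
  | right _ => 0
  end.

Definition log2 {R : realType} (r : R) : R := ln r / ln 2.

Definition log2e {R : realType} (x : \bar R) : \bar R :=
  (lne x * ((ln 2)^-1)%:E)%E.

Definition holder {R : realType} (phi : Sigma2 -> R) : Prop :=
  exists K theta : R, 0 < theta /\
    forall x y, `|phi x - phi y| <= K * dist x y `^ theta.

Definition birkhoff_sum {R : realType} (phi : Sigma2 -> R) (n : nat)
    (x : Sigma2) : R :=
  \sum_(i < n) phi (iter i shift_map x).

Definition shift_invariant {R : realType} (mu : probability Sigma2 R) : Prop :=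
  forall A : set Sigma2, measurable A -> mu (shift_map @^-1` A) = mu A.

(* Bowen's definition: for Hoelder [phi] there is exactly one such [mu], and
   [P] is necessarily the pressure of [phi].  The base 2 matches entropies in
   base 2, so that [mu] is also the maximizer of entropy + integral of [phi]. *)
Definition gibbs_measure {R : realType} (phi : Sigma2 -> R)
    (mu : probability Sigma2 R) : Prop :=
  shift_invariant mu /\
  exists P C : R, 0 < C /\
    forall (n : nat) (x : Sigma2),
      let g := 2 `^ (birkhoff_sum phi n x - n%:R * P) in
      C^-1 * g <= fine (mu (cylinder n x)) <= C * g.

(* Kolmogorov-Sinai entropy.  A finite measurable partition is given by the
   map [xi] sending a point to the index of its cell. *)
Section metric_entropy.
Context {R : realType} {d : measure_display} {T : measurableType d}.
Variables (mu : probability T R) (f : T -> T).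

Definition partition_entropy (I : finType) (A : I -> set T) : R :=
  - \sum_(i : I) fine (mu (A i)) * log2 (fine (mu (A i))).

Definition join_cell (k : nat) (xi : T -> 'I_k) (n : nat)
    (w : {ffun 'I_n -> 'I_k}) : set T :=
  [set x | forall i : 'I_n, xi (iter i f x) = w i].

Definition metric_entropy_of (k : nat) (xi : T -> 'I_k) : \bar R :=
  limn (fun n => (partition_entropy (@join_cell k xi n) / n%:R)%:E).

Definition metric_entropy : \bar R :=
  ereal_sup [set h | exists (k : nat) (xi : T -> 'I_k),
    (forall j, measurable (xi @^-1` [set j])) /\ h = metric_entropy_of xi].

End metric_entropy.

(* Bowen/Pesin topological entropy of an arbitrary subset [Z], as a Caratheodory
   dimension characteristic: [Z] is covered by the sets [string_set] of strings
   over a finite open cover [U] (a set of strings is at most countable). *)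
Section topological_entropy.
Context {R : realType} {T : topologicalType}.
Variable f : T -> T.

Fixpoint string_set (k : nat) (U : 'I_k -> set T) (w : seq 'I_k) : set T :=
  if w is i :: w' then U i `&` f @^-1` (string_set U w') else setT.

Definition string_cover (k : nat) (U : 'I_k -> set T) (Z : set T) (N : nat)
    (G : set (seq 'I_k)) : Prop :=
  (forall w, G w -> (N <= size w)%N) /\
  Z `<=` \bigcup_(w in G) string_set U w.

Definition cover_premeasure (k : nat) (U : 'I_k -> set T) (Z : set T) (s : R)
    (N : nat) : \bar R :=
  ereal_inf [set \esum_(w in G) (2 `^ (- s * (size w)%:R))%:E
            | G in string_cover U Z N].

Definition cover_measure (k : nat) (U : 'I_k -> set T) (Z : set T) (s : R) :
    \bar R :=
  limn (cover_premeasure U Z s).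

Definition entropy_of_cover (k : nat) (U : 'I_k -> set T) (Z : set T) :
    \bar R :=
  ereal_inf [set s%:E | s in [set s : R | 0 <= s /\ cover_measure U Z s = 0%E]].

Definition topological_entropy (Z : set T) : \bar R :=
  ereal_sup [set h | exists (k : nat) (U : 'I_k -> set T),
    [/\ forall j, open (U j), \bigcup_j U j = setT
      & h = entropy_of_cover U Z]].

End topological_entropy.

(* The infimum of the empty set is +oo: [x] may never hit [C_n(y)]. *)
Definition hitting_time {R : realType} (n : nat) (x y : Sigma2) : \bar R :=
  ereal_inf [set (l%:R : R)%:E
            | l in [set l : nat | (1 <= l)%N /\ cylinder n y (iter l shift_map x)]].

Definition hitting_rate {R : realType} (x y : Sigma2) : \bar R :=
  limn_einf (fun n => ((n%:R : R)^-1)%:E * log2e (hitting_time n x y))%E.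

(* Main.v *)
Require Import Defs.
From mathcomp Require Import all_boot all_order all_algebra.
From mathcomp Require Import all_classical all_reals all_analysis.
From mathcomp Require Import ring lra zify.
Import Order.TTheory GRing.Theory Num.Theory.
Local Open Scope classical_set_scope.
Local Open Scope ring_scope.

(* Bowen's inequality makes mu quasi-Bernoulli: mu[uv] is mu[u] mu[v] up to a
   bounded factor.  This replaces independence throughout.

   Since c < h(mu), the block entropies H_r exceed c r by as much as we like, and
   the maximal inequality gives, for all n, a mass bounded below of words of
   length n whose prefixes of every length m have measure at most D 2^(-c m).
   Fix s < c and a word u, and look at the blocks of length n read in x before
   time 2^(c n).  A first and second moment computation shows that, with
   probability bounded below, the blocks starting with u include a family whose
   counting measure satisfies a Frostman condition of exponent s relative to u,
   with a constant independent of u and n.  Reading disjoint windows and using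
   quasi-independence, for almost every x this happens for every u and for
   infinitely many n.

   Such an x yields a tree of words of rapidly growing length, all of them read in
   x in time; its branches y satisfy alpha(x, y) <= c.  Given a cover of these y
   by cylinders G with small sum of 2^(-t |w|), t < s, the total cost of G seen
   from a node of the tree is a supermartingale along the tree, so from the root
   one can descend keeping it below 1; the limiting branch avoids G. *)

(** * Words and quasi-Bernoulli weights *)

Fixpoint words (n : nat) : seq (seq bool) :=
  if n is m.+1 then map (cons false) (words m) ++ map (cons true) (words m)
  else [:: [::]].

Lemma mem_words n v : (v \in words n) = (size v == n).
Proof.
elim: n v => [|n IHn] [|b v] //=.
  rewrite mem_cat; apply/norP; split; apply/negP => /mapP[] //.
rewrite mem_cat eqSS -IHn; apply/orP/idP.
  by case=> /mapP[w ? [_ ->]].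
by case: b => ?; [right|left]; apply/mapP; exists v.
Qed.

Lemma words_uniq n : uniq (words n).
Proof.
elim: n => //= n IHn; rewrite cat_uniq !map_inj_uniq ?IHn /=; last 2 first.
- by move=> ? ? [].
- by move=> ? ? [].
rewrite andbT; apply/hasPn => _ /mapP[w _ ->]; apply/negP => /mapP[? _] //.
Qed.

Section Words.
Context {R : realType}.
Implicit Types (F f g : seq bool -> R) (u v w : seq bool).

Lemma big_wordsS n F :
  \sum_(w <- words n.+1) F w =
  \sum_(w <- words n) F (false :: w) + \sum_(w <- words n) F (true :: w).
Proof. by rewrite /= big_cat /= !big_map. Qed.

Lemma big_words_cat a b F :
  \sum_(w <- words (a + b)) F w =
  \sum_(u <- words a) \sum_(v <- words b) F (u ++ v).
Proof.
elim: a F => [|a IHa] F; first by rewrite big_seq1.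
by rewrite addSn !big_wordsS !IHa.
Qed.

Lemma eq_big_words n f g : (forall w, size w = n -> f w = g w) ->
  \sum_(w <- words n) f w = \sum_(w <- words n) g w.
Proof. by move=> fg; apply: eq_big_seq => w; rewrite mem_words => /eqP /fg. Qed.

Lemma ler_sum_words n f g : (forall w, size w = n -> f w <= g w) ->
  \sum_(w <- words n) f w <= \sum_(w <- words n) g w.
Proof.
move=> fg; rewrite big_seq [leRHS]big_seq; apply: ler_sum => w.
by rewrite mem_words => /eqP /fg.
Qed.

Lemma sum_words_eq n f w : size w = n ->
  \sum_(v <- words n) f v * (v == w)%:R = f w.
Proof.
move=> sw; rewrite (bigD1_seq w) ?words_uniq ?mem_words ?sw //= eqxx mulr1.
by rewrite big1 ?addr0 // => v /negbTE ->; rewrite mulr0.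
Qed.

(* The word weights [p w = mu (cylinder w)] of an invariant measure that is
   quasi-Bernoulli with constant [K]. *)
Record quasi_bernoulli (p : seq bool -> R) (K : R) : Prop := QuasiBernoulli {
  qb_nil : p [::] = 1;
  qb_gt0 : forall w, 0 < p w;
  qb_rcons : forall w, p w = p (rcons w false) + p (rcons w true);
  qb_cons : forall w, p w = p (false :: w) + p (true :: w);
  qb_le : forall u v, p (u ++ v) <= K * (p u * p v);
  qb_ge : forall u v, p u * p v <= K * p (u ++ v) }.

Section QuasiBernoulli.
Variables (p : seq bool -> R) (K : R).
Hypothesis qb : quasi_bernoulli p K.

Let p_ge0 w : 0 <= p w. Proof. by rewrite ltW // (qb_gt0 _ _ qb). Qed.

Lemma qb_const_ge1 : 1 <= K.
Proof. by have := qb_le _ _ qb [::] [::]; rewrite (qb_nil _ _ qb) !mulr1. Qed.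

Let K_ge0 : 0 <= K. Proof. by rewrite (le_trans _ qb_const_ge1). Qed.

Lemma qb_sum_catr n u : \sum_(v <- words n) p (u ++ v) = p u.
Proof.
elim: n u => [|n IHn] u; first by rewrite big_seq1 cats0.
rewrite big_wordsS (qb_rcons _ _ qb u) -!IHn.
by congr (_ + _); apply: eq_bigr => w _; rewrite cat_rcons.
Qed.

Lemma qb_sum_catl n u : \sum_(v <- words n) p (v ++ u) = p u.
Proof.
elim: n u => [|n IHn] u; first by rewrite big_seq1.
rewrite big_wordsS -IHn -big_split /=.
by apply: eq_bigr => w _; rewrite (qb_cons _ _ qb (w ++ u)).
Qed.

Lemma qb_sum n : \sum_(v <- words n) p v = 1.
Proof. by have := qb_sum_catr n [::]; rewrite (qb_nil _ _ qb). Qed.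

Lemma qb_le_prefix u v : p (u ++ v) <= p u.
Proof.
rewrite -(qb_sum_catr (size v) u) (bigD1_seq v) ?words_uniq ?mem_words //=.
by rewrite lerDl sumr_ge0.
Qed.

(** Invariance sums out the [a] letters on the left, consistency of the cylinder weights the [c]
    letters on the right. *)
Lemma expect_window a n c f :
  \sum_(v <- words (a + (n + c))) p v * f (take n (drop a v)) =
  \sum_(b <- words n) p b * f b.
Proof.
rewrite big_words_cat exchange_big /= big_words_cat.
apply: eq_big_words => b sb.
transitivity (\sum_(v <- words c) p (b ++ v) * f b).
  apply: eq_bigr => v _; rewrite -(qb_sum_catl a) mulr_suml.
  apply: eq_big_words => u su; rewrite drop_size_cat // take_size_cat //.
by rewrite -mulr_suml qb_sum_catr.
Qed.

(** Only the cut after the first window costs a factor [K]; the gap of length [d] is then summed out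
    exactly. *)
Lemma expect_window2 a n d e f g :
  (forall w, 0 <= f w) -> (forall w, 0 <= g w) ->
  \sum_(v <- words (a + (n + (d + (n + e)))))
     p v * (f (take n (drop a v)) * g (take n (drop (a + n + d) v))) <=
  K * ((\sum_(b <- words n) p b * f b) * (\sum_(b <- words n) p b * g b)).
Proof.
move=> f0 g0.
have -> : \sum_(v <- words (a + (n + (d + (n + e)))))
     p v * (f (take n (drop a v)) * g (take n (drop (a + n + d) v))) =
   \sum_(b <- words n) \sum_(v <- words (d + (n + e)))
      p (b ++ v) * (f b * g (take n (drop d v))).
  rewrite big_words_cat exchange_big /= big_words_cat.
  apply: eq_big_words => b sb; apply: eq_bigr => v _.
  rewrite -(qb_sum_catl a) mulr_suml.
  apply: eq_big_words => u su; rewrite drop_size_cat // take_size_cat //.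
  suff -> : drop (a + n + d) (u ++ b ++ v) = drop d v by [].
  by rewrite -su -sb -size_cat addnC -drop_drop catA drop_size_cat.
rewrite mulr_suml mulr_sumr; apply: ler_sum => b _.
rewrite -(expect_window d n e) !mulr_sumr; apply: ler_sum => v _.
have := qb_le _ _ qb b v => /(ler_wpM2r (mulr_ge0 (f0 b) (g0 (take n (drop d v))))).
by move=> /le_trans; apply; rewrite le_eqVlt; apply/orP; left; apply/eqP; ring.
Qed.

End QuasiBernoulli.
End Words.

(** * Words whose prefixes all have small weight *)

(** Rates are in natural units: [gam] will be [c * ln 2]. *)
Definition steady {R : realType} (p : seq bool -> R) (D gam : R) (v : seq bool) :=
  all (fun m => p (take m v) <= D * expR (- gam * m%:R)) (iota 0 (size v).+1).

Section Garsia.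
Context {R : realType}.
Variables (p : seq bool -> R) (K : R).
Hypothesis qb : quasi_bernoulli p K.
Variables (r : nat) (gam : R).
Hypotheses (r_gt0 : (0 < r)%N) (gam_gt0 : 0 < gam).

(** The summand [ln K] makes [ln p + ln K] subadditive under concatenation, so the sum of [psi] over
    consecutive blocks dominates [ln (p w) + ln K + gam * (size w)%:R] for their concatenation
    [w]. *)
Let psi b := ln (p b) + ln K + gam * r%:R.

(* The maximum of 0 and of the first [J] Birkhoff sums of [psi] along the
   consecutive [r]-blocks of [v]. *)
Fixpoint maxsum (J : nat) (v : seq bool) : R :=
  if J is j.+1 then Num.max 0 (psi (take r v) + maxsum j (drop r v)) else 0.

Lemma maxsum_ge0 J v : 0 <= maxsum J v.
Proof. by case: J => //= j; rewrite le_max lexx. Qed.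

Lemma maxsum_cat J u v : size u = (J * r)%N -> maxsum J (u ++ v) = maxsum J u.
Proof.
elim: J u => //= J IHJ u su.
have ru : (r <= size u)%N by rewrite su mulSn leq_addr.
rewrite takel_cat // drop_cat; congr (Num.max 0 (_ + _)).
have -> : (if (r < size u)%N then drop r u ++ v else drop (r - size u) v)
          = drop r u ++ v.
  case: ltnP => // ur; have -> : size u = r by apply/eqP; rewrite eqn_leq ur ru.
  by rewrite subnn drop0 drop_oversize.
by rewrite IHJ // size_drop su mulSn addKn.
Qed.

Lemma maxsumS J v : maxsum J v <= maxsum J.+1 v.
Proof.
elim: J v => [|J IHJ] v; first exact: maxsum_ge0.
rewrite /= ge_max !le_max lexx /= lerD2l; apply/orP; right; exact: IHJ.
Qed.

Lemma expect_maxsumS J :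
  \sum_(v <- words (J * r)) p v * maxsum J v <=
  \sum_(v <- words (J.+1 * r)) p v * maxsum J.+1 v.
Proof.
rewrite mulSn addnC big_words_cat; apply: ler_sum_words => u su.
rewrite -(qb_sum_catr _ _ qb r u) mulr_suml; apply: ler_sum => v _.
rewrite ler_wpM2l ?(ltW (qb_gt0 _ _ qb _)) //.
by rewrite -(maxsum_cat _ _ v su) maxsumS.
Qed.

(** By subadditivity the left side is at most the [j]-th Birkhoff sum of [psi], one of those whose
    maximum is the right side. *)
Lemma ln_prefix_le J j v : (0 < j <= J.+1)%N -> (J.+1 * r <= size v)%N ->
  ln (p (take (j * r) v)) + ln K + gam * (j * r)%:R <=
  psi (take r v) + maxsum J (drop r v).
Proof.
elim: J j v => [|J IHJ] [|[|j]] v //= jJ vJ.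
- by rewrite mul1n addr0.
- by rewrite mul1n -[leLHS]addr0 lerD // le_max lexx.
have K_gt0 : 0 < K by rewrite (lt_le_trans _ (qb_const_ge1 _ _ qb)).
have p_gt0 := qb_gt0 _ _ qb.
have -> : take (j.+2 * r) v = take r v ++ take (j.+1 * r) (drop r v).
  by rewrite mulSn takeD.
have := IHJ j.+1 (drop r v) jJ.
rewrite size_drop leq_subRL; last by apply: leq_trans vJ; rewrite mulSn leq_addr.
rewrite -mulSn => /(_ vJ) IH.
have : ln (p (take r v ++ take (j.+1 * r) (drop r v))) <=
   ln K + (ln (p (take r v)) + ln (p (take (j.+1 * r) (drop r v)))).
  rewrite -!lnM ?posrE ?mulr_gt0 // ler_ln ?posrE ?mulr_gt0 //.
  exact: (qb_le _ _ qb).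
have h : psi (take r (drop r v)) + maxsum J (drop r (drop r v)) <=
   Num.max 0 (psi (take r (drop r v)) + maxsum J (drop r (drop r v))).
  by rewrite le_max lexx orbT.
move: h IH; rewrite /psi => h IH h2.
rewrite (mulSn j.+1) natrD.
move: h h2 IH; rewrite /psi.
set M := Num.max _ _.
lra.
Qed.

(** The hypothesis makes the first [J.+1] Birkhoff sums nonpositive, which settles the prefixes
    whose length is a multiple of [r]; rounding other lengths down to a multiple costs the factor
    [expR (gam * r%:R)]. *)
Lemma steady_of_maxsum J v : size v = (J.+1 * r)%N ->
  psi (take r v) + maxsum J (drop r v) <= 0 -> steady p (expR (gam * r%:R)) gam v.
Proof.
move=> sv v0; apply/allP => m; rewrite mem_iota add0n ltnS sv => /andP[_ mv].
have p_gt0 := qb_gt0 _ _ qb.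
have le1 : p (take m v) <= p (take (m %/ r * r) v).
  have -> : take m v = take (m %/ r * r) v ++
      take (m - m %/ r * r) (drop (m %/ r * r) v).
    by rewrite -takeD subnKC // leq_divM.
  exact: qb_le_prefix qb _ _.
apply: (le_trans le1).
have m_lt : m%:R <= (m %/ r * r)%:R + r%:R :> R.
  by rewrite -natrD ler_nat {1}(divn_eq m r) leq_add2l ltnW // ltn_mod.
apply: (@le_trans _ _ (expR (- gam * (m %/ r * r)%:R))); last first.
  rewrite -expRD ler_expR mulNr mulNr lerNl opprD opprK addrC lerBlDr -mulrDr.
  by rewrite ler_pM2l.
have [->|mr0] := posnP (m %/ r)%N.
  by rewrite mul0n take0 (qb_nil _ _ qb) mulr0 expR0.
have lnK : 0 <= ln K by rewrite ln_ge0 // (qb_const_ge1 _ _ qb).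
have mJ : (m %/ r <= J.+1)%N.
  by rewrite -(mulnK J.+1 r_gt0); apply: leq_div2r.
have := ln_prefix_le J (m %/ r) v.
rewrite mr0 sv leqnn mJ => /(_ isT isT) h.
move: h; rewrite -ler_ln ?posrE ?expR_gt0 // expRK; lra.
Qed.

(** Where the sum of [psi] and [maxsum J] is negative, [maxsum J.+1] vanishes and the word is
    steady, so the term in [B] is there to compensate [psi]. *)
Lemma maxsum_step (B : R) J v : 0 <= B -> (forall b, size b = r -> - B <= psi b) ->
  size v = (J.+1 * r)%N ->
  maxsum J.+1 v <= psi (take r v) + maxsum J (drop r v) +
    B * (steady p (expR (gam * r%:R)) gam v)%:R.
Proof.
move=> B0 psiB sv /=; have := steady_of_maxsum J v sv.
have : - B <= psi (take r v).
  by apply: psiB; rewrite size_takel // sv mulSn leq_addr.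
have := maxsum_ge0 J (drop r v).
case: (leP 0 (psi (take r v) + maxsum J (drop r v))) => [ge0 M0 psi0 _|lt0 M0 psi0].
  by rewrite lerDl mulr_ge0.
move=> /(_ (ltW lt0)) ->; rewrite [X in B * X]/(1 : R) mulr1; lra.
Qed.

(* Garsia's proof of the maximal ergodic theorem: [psi] dominates the coboundary
   of [maxsum] except where [maxsum] vanishes, i.e. on steady words, so the
   negative mean of [psi] must be absorbed there. *)
Lemma steady_mass : \sum_(b <- words r) p b * psi b < 0 ->
  exists D del : R, [/\ 0 < D, 0 < del & forall n,
    del <= \sum_(v <- words n) p v * (steady p D gam v)%:R].
Proof.
move=> Epsi; pose B := 1 + \sum_(b <- words r) `|psi b|.
have B_gt0 : 0 < B by rewrite ltr_pwDl // sumr_ge0.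
have psiB b : size b = r -> - B <= psi b.
  move=> sb; rewrite lerNl (le_trans (ler_norm _)) // normrN /B.
  rewrite (bigD1_seq b) ?words_uniq ?mem_words ?sb //= addrCA lerDl.
  by rewrite addr_ge0 // sumr_ge0.
have p_ge0 w : 0 <= p w by rewrite ltW // (qb_gt0 _ _ qb).
pose D := expR (gam * r%:R).
exists D, (- (\sum_(b <- words r) p b * psi b) / B); split.
- exact: expR_gt0.
- by rewrite divr_gt0 // oppr_gt0.
move=> n; rewrite ler_pdivrMr //.
have : \sum_(v <- words (n.+1 * r)) p v * maxsum n.+1 v <=
    \sum_(v <- words (n.+1 * r)) (p v * (psi (take r v) + maxsum n (drop r v) +
    B * (steady p D gam v)%:R)).
  apply: ler_sum_words => v sv; rewrite ler_wpM2l //; by apply: maxsum_step => //; exact: ltW.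
have -> : \sum_(v <- words (n.+1 * r)) (p v * (psi (take r v) + maxsum n (drop r v) +
    B * (steady p D gam v)%:R)) = \sum_(b <- words r) p b * psi b +
  \sum_(v <- words (n * r)) p v * maxsum n v +
  B * \sum_(v <- words (n.+1 * r)) p v * (steady p D gam v)%:R.
  rewrite mulr_sumr.
  under eq_bigr => v _ do rewrite mulrDr (mulrDr _ (psi _)).
  rewrite !big_split /=; congr (_ + _ + _).
  - have := expect_window _ _ qb 0 r (n * r) psi.
    rewrite add0n -mulSn => <-; by apply: eq_bigr => v _; rewrite drop0.
  - have := expect_window _ _ qb r (n * r) 0 (maxsum n).
    rewrite addn0 -mulSn => <-; apply: eq_big_words => v sv.
    by rewrite take_oversize // size_drop sv mulSn addKn.
  - by apply: eq_bigr => v _; rewrite mulrCA.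
(* Since [E1 <= E2], the two means of [maxsum] cancel, and minus the mean of [psi] is at most
   [B * E3]. *)
have := expect_maxsumS n.
set E1 := \sum_(v <- words (n * r)) _; set E2 := \sum_(v <- words _) _ * maxsum _ _.
set E3 := \sum_(v <- words _) p v * (steady _ _ _ _)%:R => h1 h2.
(* Prefixes of steady words are steady, so the bound at length [n.+1 * r] descends to length [n]. *)
have : E3 <= \sum_(v <- words n) p v * (steady p D gam v)%:R.
  have nr : (n <= n.+1 * r)%N.
    by rewrite (leq_trans (leqnSn n)) // leq_pmulr.
  rewrite /E3 -(subnKC nr) big_words_cat; apply: ler_sum_words => u su.
  rewrite -(qb_sum_catr _ _ qb (n.+1 * r - n) u) mulr_suml; apply: ler_sum => v _.
  rewrite ler_wpM2l // ler_nat; case: (boolP (steady _ _ _ (u ++ v))) => // /allP h.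
  suff -> : steady p D gam u by [].
  apply/allP => m; rewrite mem_iota add0n ltnS => /andP[_ mu].
  have := h m; rewrite mem_iota add0n ltnS size_cat takel_cat //; apply.
  by rewrite (leq_trans mu) // leq_addr.
rewrite -(ler_pM2l B_gt0); lra.
Qed.
End Garsia.

(** * Second moment of the blocks *)

Section Geometric.
Context {R : realType}.

Lemma sum_expR_neg_le (a : R) M : 0 < a ->
  \sum_(m < M) expR (- a * m%:R) <= (1 - expR (- a))^-1.
Proof.
move=> a0; have x1 : expR (- a) < 1 by rewrite expR_lt1 oppr_lt0.
have d0 : 0 < 1 - expR (- a) by rewrite subr_gt0.
rewrite -[leRHS]mul1r ler_pdivlMr //.
suff -> : (\sum_(m < M) expR (- a * m%:R)) * (1 - expR (- a)) =
    1 - expR (- a * M%:R) by rewrite lerBlDr lerDl expR_ge0.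
elim: M => [|M IHM]; first by rewrite big_ord0 mul0r mulr0 expR0 subrr.
rewrite big_ord_recr /= mulrDl IHM -[in RHS]natr1 (mulrDr (- a)) mulr1 expRD; ring.
Qed.

Lemma sum_expR_le (a : R) M : 0 < a ->
  \sum_(m < M.+1) expR (a * m%:R) <= (1 - expR (- a))^-1 * expR (a * M%:R).
Proof.
move=> a0; have x1 : expR (- a) < 1 by rewrite expR_lt1 oppr_lt0.
have d0 : 0 < 1 - expR (- a) by rewrite subr_gt0.
rewrite mulrC -ler_pdivrMl ?expR_gt0 // -expRN mulr_sumr.
rewrite (reindex_inj rev_ord_inj) /=.
rewrite (le_trans _ (sum_expR_neg_le _ M.+1 a0)) //.
apply: ler_sum => m _; rewrite -expRD ler_expR.
by rewrite subSS natrB -1?ltnS // mulrBr addrA addNr add0r mulNr.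
Qed.

Lemma natr_count (T : Type) (P : pred T) (s : seq T) :
  (count P s)%:R = \sum_(i <- s) (P i)%:R :> R.
Proof.
rewrite -sum1_count natr_sum big_mkcond /=.
by apply: eq_bigr => i _; case: (P i).
Qed.
End Geometric.

Definition block (n i : nat) (v : seq bool) := take n (drop (i * n) v).

(* The words of [ws], each with mass [1 / size ws], satisfy a Frostman condition
   of exponent [s] (in natural units) below the cylinder [u]. *)
Definition well_spread {R : realType} (A s : R) (u : seq bool)
    (ws : seq (seq bool)) :=
  [/\ (0 < size ws)%N, forall w, w \in ws -> take (size u) w = u &
   forall m w, size w = (size u + m)%N ->
     (count (fun w' => take (size u + m) w' == w) ws)%:R <=
       A * (size ws)%:R * expR (- s * m%:R)].

Definition spread_blocks {R : realType} (A s : R) (n N : nat) (u v : seq bool) :=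
  exists ws, well_spread A s u ws /\
    forall w, w \in ws -> exists2 i, (i < N)%N & w = block n i v.

Section SecondMoment.
Context {R : realType}.
Variables (p : seq bool -> R) (K : R).
Hypothesis qb : quasi_bernoulli p K.
Variables (D gam del s : R).
Hypotheses (D_gt0 : 0 < D) (del_gt0 : 0 < del) (s_gt0 : 0 < s) (s_lt : s < gam).
Hypothesis steady_ge : forall n,
  del <= \sum_(v <- words n) p v * (steady p D gam v)%:R.

Let p_ge0 w : 0 <= p w. Proof. by rewrite ltW // (qb_gt0 _ _ qb). Qed.
Let K_gt0 : 0 < K.
Proof. by rewrite (lt_le_trans _ (qb_const_ge1 _ _ qb)). Qed.

(** [S0] and [S1] sum the geometric series of ratios [expR (- s)] and [expR (- (gam - s))]. In [A0],
    the fraction accounts for pairs of distinct blocks and the 1 for the diagonal. *)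
Let S0 : R := (1 - expR (- s))^-1.
Let S1 : R := (1 - expR (- (gam - s)))^-1.
Let A0 : R := K ^+ 3 * D * S1 / del + 1.

Let S0_gt0 : 0 < S0.
Proof. by rewrite invr_gt0 subr_gt0 expR_lt1 oppr_lt0. Qed.
Let S1_gt0 : 0 < S1.
Proof. by rewrite invr_gt0 subr_gt0 expR_lt1 oppr_lt0 subr_gt0. Qed.
Let A0_ge1 : 1 <= A0.
Proof. by rewrite lerDr divr_ge0 ?mulr_ge0 ?exprn_ge0 ?ltW. Qed.
Let A0_gt0 : 0 < A0. Proof. exact: lt_le_trans A0_ge1. Qed.

Section Fixed.
Variables (n N : nat) (u : seq bool).
Hypothesis un : (size u <= n)%N.
Local Notation k := (size u).

(** Steadiness is asked only of what follows [u], so that the constants do not depend on [u]. *)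
Let I b := (take k b == u) && steady p D gam (drop k b).
Let q := \sum_(b <- words n) p b * (I b)%:R.

Lemma mass_start_ge : del * p u <= K * q.
Proof.
rewrite /q -(subnKC un) big_words_cat mulr_sumr.
rewrite (bigD1_seq u) ?words_uniq ?mem_words //=.
rewrite -[leLHS]addr0 lerD //; last first.
  rewrite sumr_ge0 // => v _; rewrite mulr_ge0 ?(ltW K_gt0) //.
  by rewrite sumr_ge0 // => *; rewrite mulr_ge0.
rewrite mulrC (le_trans (ler_wpM2l (p_ge0 u) (steady_ge (n - k)))) //.
rewrite !mulr_sumr; apply: ler_sum => v _.
rewrite /I take_size_cat // drop_size_cat // eqxx /= !mulrA ler_wpM2r //.
exact: qb_ge qb _ _.
Qed.

Let q_gt0 : 0 < q.
Proof.
have := mass_start_ge; rewrite -(pmulr_rgt0 _ K_gt0) => /lt_le_trans; apply.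
by rewrite mulr_gt0 // (qb_gt0 _ _ qb).
Qed.

(** A discrete Riesz kernel of exponent [s]: for two marked blocks it is of the order of
    [expR (s * m%:R)], with [m] the length of their agreement beyond [u]. *)
Let kernel b b' : R := \sum_(m < (n - k).+1)
  expR (s * m%:R) * (I b && I b' && (take (k + m) b == take (k + m) b'))%:R.

Let mass m w := \sum_(b <- words n) p b * (I b && (take (k + m) b == w))%:R.

Lemma mass_ge0 m w : 0 <= mass m w.
Proof. by rewrite sumr_ge0 // => *; rewrite mulr_ge0. Qed.

(** If some block contributes, [w] is [u] followed by a prefix of a steady word, whose weight is
    controlled. *)
Lemma mass_le m w : (m <= n - k)%N -> size w = (k + m)%N ->
  mass m w <= K * p u * D * expR (- gam * m%:R).
Proof.
move=> mn sw.
have kmn : (k + m <= n)%N by rewrite -leq_subRL.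
have [/hasP[b]|/hasPn h] :=
    boolP (has (fun b => I b && (take (k + m) b == w)) (words n)); last first.
  rewrite /mass big_seq big1 => [|b /h /negbTE ->]; last by rewrite mulr0.
  by rewrite !mulr_ge0 ?expR_ge0 // ltW.
rewrite mem_words => /eqP sb /andP[/andP[/eqP bu /allP sd] /eqP bw].
have wE : w = u ++ take m (drop k b) by rewrite -bw takeD bu.
have mw : mass m w <= p w.
  rewrite -(sum_words_eq _ p _ (erefl (size w))) sw /mass.
  rewrite -(subnKC kmn) big_words_cat; apply: ler_sum_words => c sc.
  rewrite -(qb_sum_catr _ _ qb (n - (k + m)) c) mulr_suml; apply: ler_sum => d _.
  by rewrite ler_wpM2l // take_size_cat // ler_nat; case: (I _); case: eqP.
rewrite (le_trans mw) // wE (le_trans (qb_le _ _ qb _ _)) //.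
rewrite -!mulrA ler_pM2l // ler_pM2l ?(qb_gt0 _ _ qb) //.
by apply: sd; rewrite mem_iota add0n ltnS size_drop sb.
Qed.

Lemma sum_mass m : (m <= n - k)%N -> \sum_(w <- words (k + m)) mass m w = q.
Proof.
move=> mn; have kmn : (k + m <= n)%N by rewrite -leq_subRL.
rewrite exchange_big; apply: eq_big_words => b sb.
rewrite -(sum_words_eq (k + m) (fun=> p b * (I b)%:R) (take (k + m) b)); last first.
  by rewrite size_takel // sb.
apply: eq_bigr => w _; rewrite -mulrA -natrM mulnb; congr (_ * (_ && _)%:R).
exact: eq_sym.
Qed.

Lemma expect_block i f : (i < N)%N ->
  \sum_(v <- words (N * n)) p v * f (block n i v) = \sum_(b <- words n) p b * f b.
Proof.
move=> iN; have <- := expect_window _ _ qb (i * n) n ((N - i.+1) * n) f.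
by rewrite -mulSn -mulnDl [(_ + _.+1)%N]addnS -addSn subnKC.
Qed.

Lemma expect_block2 i j f g : (i < N)%N -> (j < N)%N -> i != j ->
  (forall w, 0 <= f w) -> (forall w, 0 <= g w) ->
  \sum_(v <- words (N * n)) p v * (f (block n i v) * g (block n j v)) <=
  K * ((\sum_(b <- words n) p b * f b) * (\sum_(b <- words n) p b * g b)).
Proof.
move=> iN jN ij f0 g0.
wlog lt_ij : i j f g iN jN ij f0 g0 / (i < j)%N.
  move=> W; case: (ltngtP i j) ij => // [ij|ji] _; first by apply: W; rewrite ?ltn_eqF.
  rewrite [X in K * X]mulrC; under eq_bigr do rewrite [X in _ * X]mulrC.
  by apply: W; rewrite ?ltn_eqF.
have := expect_window2 _ _ qb (i * n) n ((j - i.+1) * n) ((N - j.+1) * n) f g f0 g0.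
have -> : (i * n + (n + ((j - i.+1) * n + (n + (N - j.+1) * n))) = N * n)%N.
  by rewrite -mulSn -mulnDl -mulSn -mulnDl; congr (_ * _)%N; lia.
suff -> : (i * n + n + (j - i.+1) * n = j * n)%N by [].
by rewrite -[X in (_ + X + _)%N]mul1n -!mulnDl; congr (_ * _)%N; lia.
Qed.

Lemma kernel_ge0 b b' : 0 <= kernel b b'.
Proof. by rewrite sumr_ge0 // => m _; rewrite mulr_ge0 ?expR_ge0. Qed.

Lemma kernel_ge b b' : (I b)%:R * (I b')%:R <= kernel b b' :> R.
Proof.
rewrite /kernel big_ord_recl /= mulr0 expR0 mul1r addn0 -natrM mulnb.
rewrite -[leLHS]addr0 lerD //; last first.
  by rewrite sumr_ge0 // => m _; rewrite mulr_ge0 ?expR_ge0.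
rewrite ler_nat; case: (boolP (I b)) => // /andP[/eqP -> _].
by case: (boolP (I b')) => // /andP[/eqP -> _]; rewrite eqxx.
Qed.

Lemma expect_kernel_diag :
  \sum_(b <- words n) p b * kernel b b <= q * (S0 * expR (s * n%:R)).
Proof.
rewrite mulr_suml; apply: ler_sum => b _; rewrite -mulrA ler_wpM2l //.
rewrite /kernel; under eq_bigr do rewrite eqxx andbT andbb.
rewrite -mulr_suml mulrC ler_wpM2l // (le_trans (sum_expR_le _ _ s_gt0)) //.
by rewrite ler_pM2l // ler_expR ler_pM2l // ler_nat leq_subr.
Qed.

(** Splitting an agreement over its common value [w] gives products of a function of [b] and a
    function of [b'], to which quasi-independence applies. *)
Lemma kernelE b b' : size b' = n ->
  kernel b b' = \sum_(m < (n - k).+1) \sum_(w <- words (k + m)) expR (s * m%:R) *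
    ((I b && (take (k + m) b == w))%:R * (I b' && (take (k + m) b' == w))%:R).
Proof.
move=> sb'; apply: eq_bigr => m _; rewrite -mulr_sumr; congr (_ * _).
have kmn : (k + m <= n)%N by rewrite -leq_subRL // -ltnS.
rewrite -(sum_words_eq (k + m)
  (fun=> (I b && I b' && (take (k + m) b == take (k + m) b'))%:R) (take (k + m) b')).
  apply: eq_bigr => w _; rewrite -!natrM !mulnb; congr ((nat_of_bool _)%:R).
  case: (eqVneq w (take (k + m) b')) => [->|_]; last by rewrite !andbF.
  by rewrite !andbT andbAC.
by rewrite size_takel // sb'.
Qed.

(** At level [m] the sum of the squared masses is at most the largest mass times [q]. The decay
    [expR (- gam * m%:R)] of the masses beats the weight [expR (s * m%:R)], and the levels sum to at
    most [S1]. *)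
Lemma expect_kernel i j : (i < N)%N -> (j < N)%N -> i != j ->
  \sum_(v <- words (N * n)) p v * kernel (block n i v) (block n j v) <=
  K ^+ 3 * D * S1 / del * q ^+ 2.
Proof.
move=> iN jN ij.
have jn : (j.+1 * n <= N * n)%N by rewrite leq_mul2r jN orbT.
rewrite (eq_big_words _ _ (fun v => \sum_(m < (n - k).+1) \sum_(w <- words (k + m))
  p v * (expR (s * m%:R) * ((I (block n i v) && (take (k + m) (block n i v) == w))%:R *
    (I (block n j v) && (take (k + m) (block n j v) == w))%:R)))); last first.
  move=> v sv; rewrite kernelE; last first.
    rewrite size_takel // size_drop sv.
    by move: jn; rewrite mulSn; lia.
  by rewrite mulr_sumr; apply: eq_bigr => m _; rewrite mulr_sumr.
rewrite exchange_big /=.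
apply: (@le_trans _ _ (\sum_(m < (n - k).+1)
    (K ^+ 2 * p u * D * q) * expR (- (gam - s) * m%:R))).
  apply: ler_sum => m _; rewrite exchange_big /=.
  have mn : (m <= n - k)%N by rewrite -ltnS.
  apply: (@le_trans _ _ (\sum_(w <- words (k + m))
      expR (s * m%:R) * (K * (mass m w * mass m w)))).
    apply: ler_sum => w _.
    under eq_bigr do rewrite mulrCA.
    rewrite -mulr_sumr ler_pM2l ?expR_gt0 //.
    by apply: (expect_block2 _ _ (fun b => (I b && (take (k + m) b == w))%:R)
      (fun b => (I b && (take (k + m) b == w))%:R)).
  apply: (@le_trans _ _ (\sum_(w <- words (k + m))
      expR (s * m%:R) * (K * (K * p u * D * expR (- gam * m%:R) * mass m w)))).
    apply: ler_sum_words => w sw; rewrite ler_pM2l ?expR_gt0 // ler_pM2l //.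
    by rewrite ler_wpM2r ?mass_ge0 // mass_le.
  rewrite -!mulr_sumr sum_mass //.
  have -> : - (gam - s) * m%:R = s * m%:R + - gam * m%:R by ring.
  by rewrite expRD le_eqVlt; apply/orP; left; apply/eqP; ring.
rewrite -mulr_sumr.
have gs : 0 < gam - s by rewrite subr_gt0.
have := sum_expR_neg_le _ (n - k).+1 gs; rewrite -/S1 => hS.
have C_ge0 : 0 <= K ^+ 2 * p u * D * q.
  by rewrite !mulr_ge0 ?exprn_ge0 // ltW.
apply: (le_trans (ler_wpM2l C_ge0 hS)).
(* Trading [p u] for [K * q / del] makes the bound proportional to [q ^+ 2], uniformly in [u]. *)
have := mass_start_ge; rewrite mulrC -ler_pdivlMr // => hp.
have -> : K ^+ 2 * p u * D * q * S1 = p u * (K ^+ 2 * D * q * S1) by ring.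
have C'_ge0 : 0 <= K ^+ 2 * D * q * S1.
  by rewrite !mulr_ge0 ?exprn_ge0 // ltW.
apply: (le_trans (ler_wpM2r C'_ge0 hp)).
by rewrite le_eqVlt; apply/orP; left; apply/eqP; field; rewrite gt_eqF.
Qed.

Let hits v : R := \sum_(i < N) (I (block n i v))%:R.
Let energy v : R := \sum_(i < N) \sum_(j < N) kernel (block n i v) (block n j v).

Lemma energy_ge v : hits v ^+ 2 <= energy v.
Proof.
rewrite expr2 /hits mulr_suml; apply: ler_sum => i _; rewrite mulr_sumr.
by apply: ler_sum => j _; exact: kernel_ge.
Qed.

Lemma expect_hits : \sum_(v <- words (N * n)) p v * hits v = N%:R * q.
Proof.
rewrite /hits; under eq_bigr do rewrite mulr_sumr.
rewrite exchange_big /= (eq_bigr (fun=> q)).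
  by rewrite sumr_const card_ord mulr_natl.
by move=> i _; apply: (expect_block _ (fun b => (I b)%:R)).
Qed.

(** The hypothesis says that there are enough blocks for the diagonal terms to be dominated by the
    square of the mean number of hits. *)
Lemma expect_energy : S0 * expR (s * n%:R) <= N%:R * q ->
  \sum_(v <- words (N * n)) p v * energy v <= A0 * (N%:R * q) ^+ 2.
Proof.
move=> Nq; rewrite /energy; under eq_bigr do rewrite mulr_sumr.
rewrite exchange_big /=.
pose C := K ^+ 3 * D * S1 / del.
have C_ge0 : 0 <= C by rewrite divr_ge0 ?mulr_ge0 ?exprn_ge0 ?ltW.
apply: (@le_trans _ _ (\sum_(i < N) (N%:R * (C * q ^+ 2) + q * (N%:R * q)))).
  apply: ler_sum => i _; under eq_bigr do rewrite mulr_sumr.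
  rewrite exchange_big /= (bigD1 i) //= addrC.
  rewrite (expect_block _ (fun b => kernel b b)) // lerD //; last first.
    by rewrite (le_trans expect_kernel_diag) // ler_wpM2l // ltW.
  apply: (@le_trans _ _ (\sum_(j < N) C * q ^+ 2)); last first.
    by rewrite sumr_const card_ord mulr_natl.
  have Cq : 0 <= C * q ^+ 2 by rewrite mulr_ge0 // exprn_ge0 // ltW.
  rewrite [leRHS](bigD1 i) //= -[leLHS]add0r lerD //.
  by apply: ler_sum => j ji; apply: expect_kernel => //; rewrite eq_sym.
rewrite sumr_const card_ord -mulr_natl /A0 -/C.
by rewrite le_eqVlt; apply/orP; left; apply/eqP; ring.
Qed.

(* Discarding the blocks of large potential keeps at least half of them. *)
Lemma well_spread_blocks (x : R) v : size v = (N * n)%N -> 0 < x ->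
  x / 4 < hits v -> energy v < 4 * A0 * x * hits v ->
  spread_blocks (64 * A0) s n N u v.
Proof.
move=> sv x_gt0 xL Qx; set L := hits v in xL Qx.
have L_gt0 : 0 < L by rewrite (lt_trans _ xL) // divr_gt0.
have QL : energy v <= 16 * A0 * L ^+ 2.
  have h : 4 * A0 * L * x <= 4 * A0 * L * (4 * L).
    by rewrite ler_pM2l ?mulr_gt0 //; lra.
  by rewrite (le_trans (ltW Qx)) //; lra.
pose pot (i : 'I_N) : R := \sum_(j < N) kernel (block n i v) (block n j v).
(* By [QL] the mean potential per hit is at most [16 * A0 * L]; with a threshold twice as large,
   Markov's inequality leaves at least half of the hits. *)
pose light (i : 'I_N) := I (block n i v) && (pot i <= 32 * A0 * L).
pose idx := [seq i <- enum 'I_N | light i].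
have size_idx : (size idx)%:R = \sum_(i < N) (light i)%:R :> R.
  by rewrite size_filter natr_count big_enum.
have pot_ge0 i : 0 <= pot i by rewrite sumr_ge0 // => j _; exact: kernel_ge0.
have half : L <= 2 * (size idx)%:R.
  have : (L - (size idx)%:R) * (32 * A0 * L) <= energy v.
    rewrite size_idx -sumrB mulr_suml; apply: ler_sum => i _.
    rewrite /light -/(pot i); have := pot_ge0 i.
    case: (I _) => /=; last by rewrite subrr mul0r.
    case: (leP (pot i)) => /= [_|/ltW]; first by rewrite subrr mul0r.
    by rewrite mulr0n subr0 mul1r.
  have -> : (L - (size idx)%:R) * (32 * A0 * L) =
    16 * A0 * L * (2 * L - 2 * (size idx)%:R) by ring.
  move=> /le_trans /(_ QL); rewrite expr2 mulrA ler_pM2l ?mulr_gt0 //; lra.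
have idx_gt0 : (0 < size idx)%N.
  by rewrite -(ltr_nat R); lra.
exists [seq block n (i : 'I_N) v | i <- idx]; split; last first.
  by move=> w /mapP[i _ ->]; exists i.
split; first by rewrite size_map.
  by move=> w /mapP[i + ->]; rewrite mem_filter => /andP[/andP[/andP[/eqP]]].
move=> m w sw; rewrite size_map count_map.
have [/hasP[i]|] := boolP (has (fun i : 'I_N => take (k + m) (block n i v) == w) idx);
    last first.
  rewrite has_count -leqNgt leqn0 => /eqP ->.
  by rewrite !mulr_ge0 ?expR_ge0 // ltW.
rewrite mem_filter => /andP[/andP[Ii poti] _] /eqP iw.
have mn : (m <= n - k)%N.
  rewrite -(leq_add2l k) subnKC // -sw -iw.
  by rewrite /block takeC size_take_min geq_minl.
(* The term of level [m] in the potential of block [i] already counts all light blocks that share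
   the prefix [w]. *)
have h : (count (fun j : 'I_N => take (k + m) (block n j v) == w) idx)%:R *
    expR (s * m%:R) <= pot i.
  rewrite count_filter natr_count big_enum /= mulr_suml /pot; apply: ler_sum => j _.
  have mn' : (m < (n - k).+1)%N by rewrite ltnS.
  rewrite /kernel (bigD1 (Ordinal mn')) //= Ii iw.
  rewrite -[leLHS]addr0 lerD //; last first.
    by rewrite sumr_ge0 // => m' _; rewrite mulr_ge0 ?expR_ge0.
  rewrite mulrC ler_wpM2l ?expR_ge0 // ler_nat /light eq_sym.
  by case: (w == _); case: (I _); case: (pot j <= _).
rewrite mulNr expRN -ler_pdivrMr ?invr_gt0 ?expR_gt0 // invrK.
rewrite (le_trans h) // (le_trans poti) //.
have -> : 64 * A0 * (size idx)%:R = 32 * A0 * (2 * (size idx)%:R) by ring.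
by rewrite ler_pM2l // mulr_gt0.
Qed.

(* With [x] the mean of [hits], the function
   [hits - energy / (4 A0 x) - x / 4] has mean at least [x / 2], and it is at
   most [A0 x] because [hits ^ 2 <= energy]; so it is positive with probability
   at least [1 / (2 A0)]. *)
Lemma spread_mass : S0 * expR (s * n%:R) <= N%:R * q ->
  (2 * A0)^-1 <= \sum_(v <- words (N * n)) p v *
    (`[< spread_blocks (64 * A0) s n N u v >])%:R.
Proof.
move=> Nq; have x_gt0 : 0 < N%:R * q.
  by rewrite (lt_le_trans _ Nq) // mulr_gt0 ?expR_gt0.
have := expect_energy Nq; have := expect_hits; move: (N%:R * q) x_gt0 => x x_gt0.
set EQ := \sum_(v <- _) p v * energy v.
move=> EL EQx; pose ev v := `[< spread_blocks (64 * A0) s n N u v >].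
have c0 : 0 < 4 * A0 * x by rewrite !mulr_gt0.
have : \sum_(v <- words (N * n)) p v * (hits v - energy v / (4 * A0 * x) - x / 4)
   <= \sum_(v <- words (N * n)) A0 * x * (p v * (ev v)%:R).
  apply: ler_sum_words => v sv; rewrite mulrCA ler_wpM2l //.
  case: (boolP (ev v)) => [_|/asboolPn nev].
    rewrite mulr1 -(ler_pM2r c0) !mulrBl divfK ?gt_eqF //.
    (* Completing the square: [hits - hits ^ 2 / (4 * A0 * x)] is largest, with value [A0 * x], at
       [hits = 2 * A0 * x]. *)
    have := energy_ge v; have := sqr_ge0 (hits v - 2 * A0 * x).
    have : 0 <= x / 4 * (4 * A0 * x) by rewrite mulr_ge0 // ?ltW // divr_gt0.
    lra.
  rewrite mulr0 leNgt; apply/negP => Z_gt0; apply: nev.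
  have Q0 : 0 <= energy v by rewrite (le_trans _ (energy_ge v)) // sqr_ge0.
  have Q1 : 0 <= energy v / (4 * A0 * x) by rewrite divr_ge0 // ltW.
  apply: (well_spread_blocks x) => //; first by lra.
  rewrite mulrC -ltr_pdivrMr //.
  have : 0 <= x / 4 by rewrite divr_ge0 // ltW.
  lra.
rewrite -mulr_sumr.
have -> : \sum_(v <- words (N * n)) p v * (hits v - energy v / (4 * A0 * x) - x / 4)
   = x - EQ / (4 * A0 * x) - x / 4.
  transitivity (\sum_(v <- words (N * n)) p v * hits v -
     \sum_(v <- words (N * n)) p v * energy v / (4 * A0 * x) -
     \sum_(v <- words (N * n)) p v * (x / 4)).
    by rewrite -!sumrB; apply: eq_bigr => v _; ring.
  by rewrite EL -!mulr_suml (qb_sum _ _ qb) mul1r.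
move=> h; have : x / 2 <= A0 * x * \sum_(v <- words (N * n)) p v * (ev v)%:R.
  have : EQ / (4 * A0 * x) <= x / 4.
    rewrite ler_pdivrMr // (le_trans EQx) // le_eqVlt; apply/orP; left; apply/eqP.
    by field.
  lra.
move=> hE; rewrite -[leRHS]/(\sum_(v <- words (N * n)) p v * (ev v)%:R).
set E := \sum_(v <- _) _ in hE *.
rewrite -(ler_pM2l (mulr_gt0 A0_gt0 x_gt0)) (le_trans _ hE) //.
rewrite le_eqVlt; apply/orP; left; apply/eqP.
by field; rewrite gt_eqF.
Qed.

End Fixed.
End SecondMoment.

(** * Prefixes and the topology of the shift *)

Definition prefix (x : Sigma2) (n : nat) : seq bool := mkseq (symbol_at x) n.

Lemma size_prefix x n : size (prefix x n) = n.
Proof. exact: size_mkseq. Qed.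

Lemma prefix_take x m n : (m <= n)%N -> take m (prefix x n) = prefix x m.
Proof.
move=> mn; apply: (@eq_from_nth _ false); rewrite size_takel ?size_prefix //.
by move=> i im; rewrite nth_take // !nth_mkseq // (leq_trans im).
Qed.

Lemma iter_shiftE i x j : symbol_at (iter i shift_map x) j = symbol_at x (i + j).
Proof.
elim: i x j => [|i IHi] x j //.
by rewrite iterS -[LHS]/(symbol_at (iter i shift_map x) j.+1) IHi addnS addSn.
Qed.

Lemma prefix_drop x m n : drop m (prefix x (m + n)) = prefix (iter m shift_map x) n.
Proof.
apply: (@eq_from_nth _ false); rewrite size_drop ?size_prefix ?addKn //.
move=> i im; rewrite nth_drop !nth_mkseq ?ltn_add2l //.
by rewrite iter_shiftE.
Qed.

Lemma prefix_cat x m n : prefix x (m + n) = prefix x m ++ prefix (iter m shift_map x) n.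
Proof. by rewrite -prefix_drop -(prefix_take x m (m + n)) ?leq_addr // cat_take_drop. Qed.

Lemma cylinderE n y : cylinder n y = [set x | prefix x n = prefix y n].
Proof.
apply/seteqP; split => x /= h.
  apply: (@eq_from_nth _ false); rewrite !size_prefix // => i im.
  by rewrite !nth_mkseq // h.
move=> i im; have := congr1 (fun s => nth false s i) h.
by rewrite !nth_mkseq.
Qed.

Lemma open_symbol n b : open [set x : Sigma2 | symbol_at x n = b].
Proof.
have h : @open cantor_space (@proj nat (fun=> bool) n @^-1` [set b]).
  apply: open_comp; last exact: discrete_open.
  by move=> x _; exact: (@proj_continuous nat (fun=> bool)).
exact: h.
Qed.

Lemma open_prefix n w : open [set x : Sigma2 | prefix x n = w].
Proof.
have [sw|/eqP sw] := eqVneq (size w) n; last first.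
  suff -> : [set x : Sigma2 | prefix x n = w] = set0 by exact: open0.
  by apply/seteqP; split => x //= xw; apply: sw; rewrite -xw size_prefix.
elim: n w sw => [|n IHn] w sw.
  suff -> : [set x : Sigma2 | prefix x 0 = w] = setT by exact: openT.
  by apply/seteqP; split => x //= _; case: w sw.
case/lastP: w sw => // w b; rewrite size_rcons => -[sw].
suff -> : [set x : Sigma2 | prefix x n.+1 = rcons w b] =
    [set x | prefix x n = w] `&` [set x | symbol_at x n = b].
  by apply: openI; [exact: IHn|exact: open_symbol].
apply/seteqP; split => x /=.
  by rewrite /prefix mkseqS => /rcons_inj[].
by rewrite /prefix mkseqS => -[-> ->].
Qed.

Lemma measurable_open (A : set Sigma2) : open A -> measurable A.
Proof. exact: (@sub_sigma_algebra _ setT (@open cantor_space) A). Qed.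

Lemma measurable_prefix n w : measurable [set x : Sigma2 | prefix x n = w].
Proof. by apply: measurable_open; exact: open_prefix. Qed.

(** Otherwise points outside [A] agreeing with [x] on longer and longer prefixes would converge to
    [x] coordinatewise. *)
Lemma open_sub_prefix (A : set Sigma2) x : open A -> A x ->
  exists n, [set y : Sigma2 | prefix y n = prefix x n] `<=` A.
Proof.
move=> oA Ax; apply: contrapT => /forallNP h.
have {}h n : exists y, prefix y n = prefix x n /\ ~ A y.
  by have /existsNP[y /not_implyP ?] := h n; exists y.
have [y hy] := choice h.
have yx : (y : nat -> cantor_space) @ \oo --> (x : cantor_space).
  apply/cvg_sup => i U [V] [[W] oW <-] Wxi WU.
  apply: (filterS WU); rewrite nbhs_simpl; exists i.+1 => // j /= ij.
  have [+ _] := hy j => /(congr1 (fun s => nth false s i)).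
  by rewrite !nth_mkseq // /symbol_at => ->.
have : nbhs (x : cantor_space) A by apply: open_nbhs_nbhs.
by move=> /yx; rewrite nbhs_simpl => -[N _ /(_ N (leqnn N))] /=; case: (hy N).
Qed.

Lemma open_prefixP (A : set Sigma2) :
  (forall x, A x -> exists n, [set y : Sigma2 | prefix y n = prefix x n] `<=` A) ->
  open A.
Proof.
move=> h; suff -> : A = \bigcup_(nx in [set nx : nat * Sigma2 |
   [set y : Sigma2 | prefix y nx.1 = prefix nx.2 nx.1] `<=` A])
   [set y : Sigma2 | prefix y nx.1 = prefix nx.2 nx.1].
  by apply: bigcup_open => nx _; exact: open_prefix.
apply/seteqP; split => x; last by case=> nx h1 /h1.
by move=> /h[n hn]; exists (n, x).
Qed.

Lemma open_shift_preimage (A : set Sigma2) : open A -> open (shift_map @^-1` A).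
Proof.
move=> oA; apply: open_prefixP => x Ax.
have [n hn] := open_sub_prefix _ _ oA Ax; exists n.+1 => y /= yx.
apply: hn => /=; rewrite -![shift_map _]/(iter 1 shift_map _).
by rewrite -!(prefix_drop _ 1) add1n yx.
Qed.

Lemma measurable_shift : measurable_fun setT shift_map.
Proof.
have h := @measurability _ _ Sigma2 Sigma2 setT shift_map (@open cantor_space).
apply h; first by [].
move=> _ [A oA <-]; rewrite setTI.
by apply: measurable_open; exact: open_shift_preimage.
Qed.

Lemma measurable_iter_shift i : measurable_fun setT (iter i shift_map).
Proof.
elim: i => [|i IHi]; first exact: measurable_id.
exact: (measurableT_comp measurable_shift IHi).
Qed.

(** * Finite-valued maps and the cylinder weights of a Gibbs measure *)

Section Fibers.
Context {R : realType} {d : measure_display} {T : measurableType d}.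
Variables (mu : probability T R) (X : eqType) (g : T -> X).
Hypothesis mg : forall i, measurable (g @^-1` [set i]).

Lemma fine_measure_fibers_in (s : seq X) (P : pred X) : uniq s ->
  measurable [set x | g x \in s /\ P (g x)] /\
  fine (mu [set x | g x \in s /\ P (g x)]) =
  \sum_(i <- s) fine (mu (g @^-1` [set i])) * (P i)%:R.
Proof.
elim: s => [|i s IHs] /=.
  rewrite (_ : [set x | _] = set0); last by apply/seteqP; split => x // -[].
  by rewrite big_nil measure0.
move=> /andP[is_ us]; have [ms es] := IHs us; rewrite big_cons.
set B := [set x | g x \in s /\ P (g x)] in ms es *.
have -> : [set x | g x \in i :: s /\ P (g x)] =
    (if P i then g @^-1` [set i] else set0) `|` B.
  apply/seteqP; split => x.
    rewrite /= inE => -[/orP[/eqP gx Px|gx Px]]; last by right.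
    by left; rewrite -gx Px.
  case=> [|[gx Px]]; last by split => //=; rewrite inE gx orbT.
  by case: ifP => // Pi /= ->; rewrite inE eqxx.
have mA : measurable (if P i then g @^-1` [set i] else set0).
  by case: ifP => // _.
split; first exact: measurableU.
rewrite measureU //; last first.
  apply/seteqP; split => x // -[]; case: ifP => // _ /= gi [gs _].
  by move: is_; rewrite -gi gs.
rewrite fineD ?fin_num_measure // es; congr (_ + _).
by case: ifP; rewrite ?mulr1 ?mulr0 ?measure0.
Qed.

Lemma fine_measure_fibers (s : seq X) (P : pred X) : uniq s ->
  (forall x, g x \in s) ->
  measurable [set x | P (g x)] /\
  fine (mu [set x | P (g x)]) =
  \sum_(i <- s) fine (mu (g @^-1` [set i])) * (P i)%:R.
Proof.
move=> us gs; have := fine_measure_fibers_in s P us.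
suff -> : [set x | g x \in s /\ P (g x)] = [set x | P (g x)] by [].
by apply/seteqP; split => x //= -[].
Qed.
End Fibers.

Definition weight {R : realType} (mu : probability Sigma2 R) (w : seq bool) : R :=
  fine (mu [set x : Sigma2 | prefix x (size w) = w]).

Lemma weight_prefix {R : realType} (mu : probability Sigma2 R) n (P : pred (seq bool)) :
  measurable [set x : Sigma2 | P (prefix x n)] /\
  fine (mu [set x : Sigma2 | P (prefix x n)]) =
  \sum_(w <- words n) weight mu w * (P w)%:R.
Proof.
have := fine_measure_fibers mu _ (fun x => prefix x n) _ (words n) P (words_uniq n).
move=> /(_ (measurable_prefix n)) [].
  by move=> x; rewrite mem_words size_prefix.
move=> ? ->; split => //; apply: eq_big_words => w sw.
by rewrite /weight sw.
Qed.

(** The comparison function [g] is exactly multiplicative along orbits, so relating the weight of a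
    concatenation to those of its two pieces uses the Gibbs bounds three times, hence [C ^+ 3]. *)
Lemma gibbs_quasi_bernoulli {R : realType} (phi : Sigma2 -> R)
    (mu : probability Sigma2 R) :
  gibbs_measure phi mu -> exists K, quasi_bernoulli (weight mu) K.
Proof.
move=> [inv [P [C [C_gt0 gibbs]]]]; exists (C ^+ 3).
(* Padding [w] with the default symbol [false] gives a point of its cylinder. *)
pose x_ w : Sigma2 := fun i => nth false w i.
have xw w v : prefix (x_ (w ++ v)) (size w) = w.
  apply: (@eq_from_nth _ false); rewrite size_prefix // => i iw.
  by rewrite nth_mkseq // /symbol_at /x_ nth_cat iw.
pose g n x : R := 2 `^ (birkhoff_sum phi n x - n%:R * P).
have g_gt0 n x : 0 < g n x by rewrite powR_gt0.
have gD m n x : g (m + n)%N x = g m x * g n (iter m shift_map x).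
  rewrite /g -powRD; last by apply/implyP => _; rewrite pnatr_eq0.
  congr (_ `^ _); rewrite /birkhoff_sum big_split_ord /= natrD mulrDl.
  under [X in _ + X - _ = _]eq_bigr do rewrite addnC iterD.
  by rewrite opprD addrACA.
have bnd n x w : prefix x n = w ->
    C^-1 * g n x <= weight mu w /\ weight mu w <= C * g n x.
  move=> <-; rewrite /weight size_prefix -cylinderE.
  by have /andP := gibbs n x.
have wgt u v : exists x, prefix x (size u + size v) = u ++ v /\
    prefix x (size u) = u /\ prefix (iter (size u) shift_map x) (size v) = v.
  exists (x_ (u ++ v)); split.
    by have := xw (u ++ v) [::]; rewrite cats0 size_cat.
  split => //; rewrite -prefix_drop.
  by have := xw (u ++ v) [::]; rewrite cats0 size_cat => ->; rewrite drop_size_cat.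
have w0 : forall w, 0 < weight mu w.
  move=> w; have := xw w [::]; rewrite cats0 => h.
  have [+ _] := bnd _ _ _ h; apply: lt_le_trans.
  by rewrite mulr_gt0 ?invr_gt0.
split => //.
- rewrite /weight (_ : [set x | _] = setT) ?probability_setT //.
  by apply/seteqP.
- move=> w; have [_] := weight_prefix mu (size w).+1 (fun v => take (size w) v == w).
  rewrite -addn1 big_words_cat -[[set x | _]]/([set x : Sigma2 | _]).
  have -> : [set x : Sigma2 | take (size w) (prefix x (size w + 1)) == w] =
      [set x : Sigma2 | prefix x (size w) = w].
    apply/seteqP; split => x /=; rewrite prefix_take ?leq_addr //.
      by move/eqP.
    by move=> ->.
  rewrite -/(weight mu w) => ->.
  rewrite (eq_big_words _ _ (fun u => \sum_(v <- words 1) weight mu (u ++ v) * (u == w)%:R)).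
    under eq_bigr do rewrite -mulr_suml.
    rewrite (sum_words_eq _ (fun u => \sum_(v <- words 1) weight mu (u ++ v))) //.
    by rewrite !big_cons big_nil addr0 !cats1.
  by move=> u su; apply: eq_bigr => v _; rewrite take_size_cat.
- move=> w.
  have := inv _ (measurable_prefix (size w) w).
  have [_] := weight_prefix mu (1 + size w) (fun v => drop 1 v == w).
  have -> : [set x : Sigma2 | drop 1 (prefix x (1 + size w)) == w] =
      shift_map @^-1` [set x : Sigma2 | prefix x (size w) = w].
    have E x : drop 1 (prefix x (1 + size w)) = prefix (shift_map x) (size w).
      by rewrite prefix_drop.
    by under eq_set do rewrite E; apply/seteqP; split => x /= /eqP.
  move=> + h; rewrite h -/(weight mu w) => ->.
  rewrite add1n big_wordsS /=.
  under eq_bigr do rewrite drop0.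
  under [X in _ + X]eq_bigr do rewrite drop0.
  rewrite (sum_words_eq _ (fun u => weight mu (false :: u))) //.
  by rewrite (sum_words_eq _ (fun u => weight mu (true :: u))).
- move=> u v; have [x [/bnd[_ h] [/bnd[h1 _] /bnd[h2 _]]]] := wgt u v.
  rewrite (le_trans h) // gD.
  have -> : C * (g (size u) x * g (size v) (iter (size u) shift_map x)) =
     C ^+ 3 * ((C^-1 * g (size u) x) * (C^-1 * g (size v) (iter (size u) shift_map x))).
    by field; rewrite gt_eqF.
  by rewrite ler_pM2l ?exprn_gt0 // ler_pM // ltW // mulr_gt0 // invr_gt0.
- move=> u v; have [x [/bnd[h _] [/bnd[_ h1] /bnd[_ h2]]]] := wgt u v.
  have C3 : 0 < C ^+ 3 by rewrite exprn_gt0.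
  rewrite (le_trans _ (ler_wpM2l (ltW C3) h)) // gD.
  have -> : C ^+ 3 * (C^-1 * (g (size u) x * g (size v) (iter (size u) shift_map x))) =
     (C * g (size u) x) * (C * g (size v) (iter (size u) shift_map x)).
    by field; rewrite gt_eqF.
  by rewrite ler_pM // ltW.
Qed.

(** * Almost every point is rich *)

(** Only the threshold [B] on the number of blocks depends on [u], through [p u]; the Frostman
    constant [A] and the probability [p0] serve all words. *)
Lemma exists_spread_mass {R : realType} (p : seq bool -> R) (K D gam del s : R) :
  quasi_bernoulli p K -> 0 < D -> 0 < del -> 0 < s -> s < gam ->
  (forall n, del <= \sum_(v <- words n) p v * (steady p D gam v)%:R) ->
  exists A p0 : R, [/\ 1 <= A, 0 < p0, p0 <= 1 &
    forall u, exists2 B : R, 0 <= B & forall n N, (size u <= n)%N ->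
      B * expR (s * n%:R) <= N%:R ->
      p0 <= \sum_(v <- words (N * n)) p v * (`[< spread_blocks A s n N u v >])%:R].
Proof.
move=> qb D0 del0 s0 sgam ge_del.
have K_gt0 : 0 < K by rewrite (lt_le_trans _ (qb_const_ge1 _ _ qb)).
pose A0 := K ^+ 3 * D * (1 - expR (- (gam - s)))^-1 / del + 1.
pose S0 := (1 - expR (- s))^-1.
have S0_gt0 : 0 < S0 by rewrite invr_gt0 subr_gt0 expR_lt1 oppr_lt0.
have A0_ge1 : 1 <= A0.
  rewrite lerDr divr_ge0 ?mulr_ge0 ?exprn_ge0 ?ltW // invr_gt0.
  by rewrite subr_gt0 expR_lt1 oppr_lt0 subr_gt0.
exists (64 * A0), (2 * A0)^-1; split.
- lra.
- by rewrite invr_gt0 mulr_gt0 // (lt_le_trans _ A0_ge1).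
- rewrite invf_le1; first lra.
  by rewrite mulr_gt0 // (lt_le_trans _ A0_ge1).
move=> u; have pu := qb_gt0 _ _ qb u.
have dp : 0 < del * p u by rewrite mulr_gt0.
exists (S0 * K / (del * p u)).
  by rewrite divr_ge0 // ?mulr_ge0 // ltW.
move=> n N un BN; apply: (spread_mass _ _ qb _ _ _ _ D0 del0 s0 sgam ge_del) => //.
have := mass_start_ge _ _ qb D gam del ge_del n u un.
set q := \sum_(b <- _) _ => hq.
rewrite -/S0; have N0 : 0 <= N%:R :> R by [].
have hq' : del * p u / K <= q by rewrite ler_pdivrMr // [leRHS]mulrC.
rewrite (le_trans _ (ler_wpM2l N0 hq')) //.
have -> : S0 * expR (s * n%:R) =
    (S0 * K / (del * p u) * expR (s * n%:R)) * (del * p u / K).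
  by field; rewrite !gt_eqF.
by rewrite ler_wpM2r // divr_ge0 // ltW.
Qed.

(** About [expR (s * n%:R)] blocks are needed. Reading them after time [T] still ends before
    [expR (gam * n%:R)], because the exponential gap absorbs the factor [n]. *)
Lemma exists_scale {R : realType} (B s gam : R) (T M : nat) :
  0 <= B -> 0 <= s -> s < gam -> exists n N, [/\ (M <= n)%N,
    B * expR (s * n%:R) <= N%:R & (T + N * n)%:R <= expR (gam * n%:R)].
Proof.
move=> B0 s0 sgam; pose eta := (gam - s) / 2.
have eta0 : 0 < eta by rewrite divr_gt0 // subr_gt0.
(* For [n] above [X], [(eta * n) ^ 2] dominates [(B + T + 1) * n], and [expR (eta * n)] dominates
   [eta * n]. *)
pose X := (B + T%:R + 1) / eta ^+ 2.
have X0 : 0 <= X by rewrite divr_ge0 ?sqr_ge0 // !addr_ge0.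
pose n := (maxn M (Num.trunc X).+1).
have nX : B + T%:R + 1 <= eta ^+ 2 * n%:R.
  rewrite mulrC -ler_pdivrMr ?exprn_gt0 // -/X ltW //.
  by rewrite -truncn_lt_nat // leq_max leqnn orbT.
have n0 : (0 < n)%N by rewrite leq_max orbT.
have n1 : 1 <= n%:R :> R by rewrite ler1n.
have e1 : 1 <= expR (s * n%:R) by rewrite -expR0 ler_expR mulr_ge0.
have Be : 0 <= B * expR (s * n%:R) by rewrite mulr_ge0 ?expR_ge0.
exists n, (Num.trunc (B * expR (s * n%:R))).+1; split.
- by rewrite leq_max leqnn.
- by rewrite ltW // -truncn_lt_nat.
have hN : (Num.trunc (B * expR (s * n%:R))).+1%:R <= B * expR (s * n%:R) + 1.
  by rewrite -natr1 lerD2r -truncn_ge_nat.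
set N := (Num.trunc _).+1 in hN *.
have main : (B + T%:R + 1) * n%:R <= expR (eta * n%:R) ^+ 2.
  apply: (@le_trans _ _ ((eta * n%:R) ^+ 2)).
    by rewrite exprMn expr2 [n%:R ^+ 2]expr2 mulrA ler_wpM2r // -expr2.
  have := expR_ge1Dx (eta * n%:R) => h.
  have h0 : 0 <= eta * n%:R by rewrite mulr_ge0 // ltW.
  rewrite ler_sqr ?nnegrE ?expR_ge0 //; lra.
have -> : gam * n%:R = s * n%:R + (eta * n%:R + eta * n%:R) by rewrite /eta; field.
rewrite !expRD -expr2 natrD natrM.
apply: (@le_trans _ _ (expR (s * n%:R) * ((B + T%:R + 1) * n%:R))); last first.
  by rewrite ler_pM2l ?expR_gt0.
apply: (@le_trans _ _ (T%:R + (B * expR (s * n%:R) + 1) * n%:R)).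
  by rewrite lerD2l ler_wpM2r.
have T0 : 0 <= T%:R :> R by [].
move: (expR _) e1 {Be hN N main nX} => e e1.
have : T%:R <= T%:R * (e * n%:R).
  by rewrite ler_peMr // mulr_ege1.
have : n%:R <= e * n%:R by rewrite ler_peMl.
lra.
Qed.

(* [gam] is [c] in natural units: the words of [ws] are read in [x] before
   time [2 ^ (c n) = expR (gam n)]. *)
Definition rich_at {R : realType} (A s gam : R) (u : seq bool) (M : nat)
    (x : Sigma2) :=
  exists n ws, [/\ (M <= n)%N, (size u <= n)%N, well_spread A s u ws &
    forall w, w \in ws -> size w = n /\
      exists l, [/\ (1 <= l)%N, l%:R <= expR (gam * n%:R) &
        prefix (iter l shift_map x) n = w]].

Definition rich {R : realType} (A s gam : R) (x : Sigma2) :=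
  forall u M, rich_at A s gam u M x.

Section AlmostSure.
Context {R : realType} (mu : probability Sigma2 R) (K : R).
Hypothesis qb : quasi_bernoulli (weight mu) K.
Local Notation p := (weight mu).

(** After each failure a fresh window is read. By quasi-independence it succeeds with probability at
    least [p0 / K] whatever the past, so [J] successive failures have probability at most
    [rho ^+ J]. *)
Lemma ae_rich (D gam del s : R) : 0 < D -> 0 < del -> 0 < s -> s < gam ->
  (forall n, del <= \sum_(v <- words n) p v * (steady p D gam v)%:R) ->
  exists2 A, 1 <= A & {ae mu, forall x, rich A s gam x}.
Proof.
move=> D0 del0 s0 sgam ge_del.
have K_ge1 := qb_const_ge1 _ _ qb.
have K_gt0 : 0 < K by rewrite (lt_le_trans _ K_ge1).
have [A [p0 [A1 p00 p01 spread]]] :=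
  exists_spread_mass _ _ _ _ _ _ qb D0 del0 s0 sgam ge_del.
exists A => //; pose rho := 1 - p0 / K.
have rho0 : 0 <= rho by rewrite subr_ge0 ler_pdivrMr // mul1r (le_trans p01).
have rho1 : rho < 1 by rewrite gtrBl divr_gt0.
pose good := rich_at A s gam.
suff ae_good u M : {ae mu, forall x, good u M x}.
  (* There are countably many pairs of a word and a length; [unpickle] enumerates them. *)
  have : {ae mu, forall x, forall i, if unpickle i is Some uM
      then good (uM : seq bool * nat).1 uM.2 x else True}.
    apply: ae_foralln => i; case: (unpickle i) => [[u M]|]; first exact: ae_good.
    exact: aeW.
  apply: filterS => x h u M; have := h (pickle (u, M)).
  by rewrite pickleK.
have step J : exists (T : nat) (P : pred (seq bool)), [/\ (0 < T)%N,
    [set x | ~ good u M x] `<=` [set x : Sigma2 | P (prefix x T)] &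
    \sum_(w <- words T) p w * (P w)%:R <= rho ^+ J].
  elim: J => [|J [T [P [T0 sub PJ]]]].
    (* Reading starts at time 1, not 0, because hitting times are at least 1. *)
    exists 1%N, predT; split => //.
    by rewrite expr0; under eq_bigr do rewrite mulr1; rewrite (qb_sum _ _ qb).
  have [B B0 hB] := spread u.
  have [n [N [Mn BN TN]]] := exists_scale B s gam T (maxn M (size u)) B0 (ltW s0) sgam.
  move: Mn; rewrite geq_max => /andP[Mn un].
  exists (T + N * n)%N, (fun w => P (take T w) &&
    ~~ `[< spread_blocks A s n N u (drop T w) >]); split.
  - by rewrite addn_gt0 T0.
  - move=> x bad /=; rewrite prefix_take ?leq_addr //.
    apply/andP; split; first exact: sub.
    rewrite prefix_drop; apply/negP => /asboolP[ws [spr hws]]; apply: bad.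
    exists n, ws; split => // w /hws[i iN ->].
    have inN : (i * n + n <= N * n)%N by rewrite addnC -mulSn leq_mul2r iN orbT.
    have bE : block n i (prefix (iter T shift_map x) (N * n)) =
        prefix (iter (T + i * n) shift_map x) n.
      rewrite /block -(subnKC (leq_trans (leq_addr _ _) inN)) prefix_drop.
      rewrite -iterD addnC prefix_take // -(leq_add2l (i * n)) subnKC //.
      exact: leq_trans (leq_addr _ _) inN.
    rewrite bE size_prefix; split => //; exists (T + i * n)%N; split => //.
      by rewrite addn_gt0 T0.
    by rewrite (le_trans _ TN) // ler_nat leq_add2l (leq_trans _ inN) // leq_addr.
  rewrite big_words_cat exprS.
  apply: (@le_trans _ _ (rho * \sum_(w <- words T) p w * (P w)%:R)); last first.
    by rewrite ler_wpM2l.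
  rewrite mulr_sumr; apply: ler_sum_words => w sw.
  under eq_bigr do rewrite take_size_cat // drop_size_cat //.
  case: (P w) => /=; last by rewrite big1 ?mulr0 // => v _; rewrite mulr0.
  rewrite mulr1.
  have -> : \sum_(v <- words (N * n)) p (w ++ v) *
       (~~ `[< spread_blocks A s n N u v >])%:R =
      p w - \sum_(v <- words (N * n)) p (w ++ v) *
       (`[< spread_blocks A s n N u v >])%:R.
    rewrite -(qb_sum_catr _ _ qb (N * n) w) -sumrB; apply: eq_bigr => v _.
    by case: `[< _ >]; rewrite ?mulr0 ?mulr1 ?subr0 ?subrr.
  rewrite /rho mulrBl mul1r lerD2l lerN2.
  have h := ler_wpM2r (ltW (qb_gt0 _ _ qb w)) (hB n N un BN).
  rewrite (mulrAC p0) ler_pdivrMr // [leRHS]mulrC (le_trans h) // mulr_suml mulr_sumr.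
  apply: ler_sum => v _.
  by rewrite mulrAC mulrA ler_wpM2r // [leLHS]mulrC; exact: qb_ge qb _ _.
pose T J := projT1 (cid (step J)).
have /choice[P hP] : forall J, exists P : pred (seq bool), [/\ (0 < T J)%N,
    [set x | ~ good u M x] `<=` [set x : Sigma2 | P (prefix x (T J))] &
    \sum_(w <- words (T J)) p w * (P w)%:R <= rho ^+ J].
  by move=> J; exact: (projT2 (cid (step J))).
have mP J := (weight_prefix mu (T J) (P J)).1.
exists (\bigcap_J [set x : Sigma2 | P J (prefix x (T J))]); split.
- exact: bigcapT_measurable.
- set Z := \bigcap_J _.
  have mZ : measurable Z by exact: bigcapT_measurable.
  have finZ : mu Z \is a fin_num by exact: fin_num_measure.
  have Zle J : fine (mu Z) <= rho ^+ J.
    have [_ _] := hP J; apply: le_trans; rewrite -(weight_prefix mu (T J) (P J)).2.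
    rewrite fine_le ?fin_num_measure //.
    by apply: le_measure; rewrite ?inE // => x /(_ J); exact.
  apply/eqP; rewrite eq_le measure_ge0 andbT -(fineK finZ) lee_fin.
  have rhoJ : rho ^+ J @[J --> \oo] --> 0 by apply: cvg_expr; rewrite ger0_norm.
  by apply: (@cvgr_to_ge _ _ _ _ _ _ _ rhoJ); exists 0%N => // J _; exact: Zle.
by move=> x bad J _; have [_ + _] := hP J; apply.
Qed.
End AlmostSure.

(** * Branches avoiding a cheap cover *)

Section Cost.
Context {R : realType}.
Variables (A t : R).
Hypothesis A_ge1 : 1 <= A.

(** An estimate, of exponent [t], for the chance that a random branch through [u] enters the
    cylinder of [b]; it is 0 or 1 once [u] is long enough to decide. *)
Definition cost (u b : seq bool) : R :=
  if (size b <= size u)%N then (take (size b) u == b)%:R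
  else A * expR (- t * (size b - size u)%:R) * (take (size u) b == u)%:R.

Let A_ge0 : 0 <= A. Proof. exact: le_trans A_ge1. Qed.

Lemma cost_ge0 u b : 0 <= cost u b.
Proof. by rewrite /cost; case: ifP => // _; rewrite !mulr_ge0 ?expR_ge0. Qed.

(* With the words of [ws] equally likely, [cost _ b] is a supermartingale. *)
Lemma sum_cost_le s n u ws b : t <= s -> well_spread A s u ws ->
  (forall w, w \in ws -> size w = n) -> (size u <= n)%N ->
  A * expR (- s * (n - size u)%:R) <= expR (- t * (n - size u)%:R) ->
  \sum_(w <- ws) cost w b <= \sum_(w <- ws) cost u b.
Proof.
move=> ts [_ wu wcount] wn un An.
have [bu|ub] := leqP (size b) (size u).
  rewrite big_seq [leRHS]big_seq; apply: ler_sum => w wws.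
  rewrite /cost bu (wn _ wws) (leq_trans bu un).
  by rewrite -(wu _ wws) take_takel.
have const : \sum_(w <- ws) cost u b = (size ws)%:R * cost u b.
  by rewrite big_const_seq count_predT iter_addr_0 mulr_natl.
have [bE|/eqP bu] := eqVneq (take (size u) b) u; last first.
  rewrite [leLHS]big_seq big1 => [|w wws]; last first.
    rewrite /cost (wn _ wws); case: leqP => bn.
      case: eqP => // wb; case: bu.
      by rewrite -[X in take _ X]wb take_takel ?wu // ltnW.
    case: eqP => [bw|]; last by rewrite mulr0.
    by case: bu; rewrite -(take_takel b un) bw wu.
  by rewrite sumr_ge0 // => *; exact: cost_ge0.
rewrite const /cost leqNgt ub /= bE eqxx mulr1.
(* If [b] is no longer than the new words, the Frostman constant is the [A] in the cost of [u]. If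
   it is longer, that [A] is still present in the cost of the new words, and [An] absorbs the
   Frostman constant. *)
have [bn|nb] := leqP (size b) n.
  rewrite (_ : \sum_(w <- ws) _ =
      (count (fun w => take (size u + (size b - size u)) w == b) ws)%:R); last first.
    rewrite natr_count subnKC ?(ltnW ub) //; apply: eq_big_seq => w wws.
    by rewrite (wn _ wws) bn.
  rewrite (le_trans (wcount _ _ _)) ?subnKC ?(ltnW ub) //.
  rewrite mulrCA mulrA ler_wpM2l ?mulr_ge0 // ler_expR !mulNr lerN2.
  by rewrite ler_wpM2r.
have nE : n = (size u + (n - size u))%N by rewrite subnKC.
rewrite (_ : \sum_(w <- ws) _ = A * expR (- t * (size b - n)%:R) *
   (count (fun w => take (size u + (n - size u)) w == take n b) ws)%:R); last first.
  rewrite natr_count -nE mulr_sumr; apply: eq_big_seq => w wws.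
  by rewrite (wn _ wws) leqNgt nb /= (@take_oversize _ n w) ?(wn _ wws) // eq_sym.
have e0 : 0 <= A * expR (- t * (size b - n)%:R) by rewrite mulr_ge0 ?expR_ge0.
have cn : (count (fun w => take (size u + (n - size u)) w == take n b) ws)%:R <=
   A * (size ws)%:R * expR (- s * (n - size u)%:R).
  by apply: wcount; rewrite -nE size_takel // ltnW.
rewrite (le_trans (ler_wpM2l e0 cn)) //.
have -> : A * expR (- t * (size b - n)%:R) *
  (A * (size ws)%:R * expR (- s * (n - size u)%:R)) =
  (A * expR (- t * (size b - n)%:R) * (size ws)%:R) *
  (A * expR (- s * (n - size u)%:R)) by ring.
have q0 : 0 <= A * expR (- t * (size b - n)%:R) * (size ws)%:R by rewrite mulr_ge0.
rewrite (le_trans (ler_wpM2l q0 An)) //.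
have -> : (size b - size u = (size b - n) + (n - size u))%N.
  by rewrite addnBA // subnK // ltnW.
rewrite natrD mulrDr expRD.
by rewrite le_eqVlt; apply/orP; left; apply/eqP; ring.
Qed.

Variables (X : choiceType) (G : set X) (code : X -> seq bool).

Definition total_cost u : \bar R := \esum_(w in G) (cost u (code w))%:E.

(** The mean over [ws] of the total costs is at most the total cost of [u], so not all of them can
    reach 1. *)
Lemma exists_child s n u ws : t <= s -> well_spread A s u ws ->
  (forall w, w \in ws -> size w = n) -> (size u <= n)%N ->
  A * expR (- s * (n - size u)%:R) <= expR (- t * (n - size u)%:R) ->
  (total_cost u < 1)%E -> exists2 w, w \in ws & (total_cost w < 1)%E.
Proof.
move=> ts wsp wn un An Fu; apply: contrapT => /forall2NP h.
have ge1 w : w \in ws -> (1 <= total_cost w)%E.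
  by move=> wws; case: (h w) => // /negP; rewrite -leNgt.
have Fu0 : (0 <= total_cost u)%E by apply: esum_ge0 => b _; rewrite lee_fin cost_ge0.
have le1 : (\sum_(w <- ws) total_cost w <= \sum_(w <- ws) total_cost u)%E.
  rewrite /total_cost -!esum_sum; do ?by move=> *; rewrite lee_fin cost_ge0.
  apply: le_esum => b _; rewrite !sumEFin lee_fin.
  exact: (sum_cost_le s n).
have le2 : ((size ws)%:R%:E <= \sum_(w <- ws) total_cost w)%E.
  have -> : ((size ws)%:R%:E = \sum_(w <- ws) (1%:E : \bar R))%E.
    by rewrite sumEFin big_const_seq count_predT iter_addr_0.
  rewrite big_seq [leRHS]big_seq; apply: lee_sum => w; exact: ge1.
have := le_trans le2 le1.
have -> : total_cost u = (fine (total_cost u))%:E.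
  by rewrite fineK // ge0_fin_numE // (lt_trans Fu) // ltry.
rewrite sumEFin big_const_seq count_predT iter_addr_0 lee_fin.
rewrite -[X in _ <= X]mulr_natl.
case: wsp => ws0 _ _.
rewrite -[leLHS]mulr1 ler_pM2l ?ltr0n // leNgt => /negP; apply.
by rewrite -lte_fin fineK // ge0_fin_numE // (lt_trans Fu) // ltry.
Qed.

(** Contrapositively, a node of total cost below 1 lies in no cylinder of the cover. *)
Lemma total_cost_prefix u w : G w -> (size (code w) <= size u)%N ->
  take (size (code w)) u = code w -> (1 <= total_cost u)%E.
Proof.
move=> Gw wu uw; apply: esum_ge; exists [set w].
  by split => // _ ->.
by rewrite fsbig_set1 /cost wu uw eqxx.
Qed.

(** At each node richness offers a spread family of longer words read in [x] in time, and some
    member keeps the total cost below 1; the nodes so chosen extend one another and define [y]. *)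
Lemma exists_branch s gam x : t < s -> rich A s gam x -> (total_cost [::] < 1)%E ->
  exists y : Sigma2, (forall w, G w -> prefix y (size (code w)) <> code w) /\
    forall M, exists n l, [/\ (M <= n)%N, (1 <= l)%N, l%:R <= expR (gam * n%:R) &
      prefix (iter l shift_map x) n = prefix y n].
Proof.
move=> ts rx F0.
pose S := {u : seq bool | (total_cost u < 1)%E}.
have next (u : S) : exists v : S, [/\ (size (val u) < size (val v))%N,
   take (size (val u)) (val v) = val u & exists l, [/\ (1 <= l)%N,
    l%:R <= expR (gam * (size (val v))%:R) &
    prefix (iter l shift_map x) (size (val v)) = val v]].
  case: u => u Fu /=.
  (* Lengthening [u] by at least [N] letters brings [A * expR (- (s - t) * N%:R)] below 1, as
     [exists_child] requires. *)
  pose N := (Num.trunc (ln A / (s - t))).+1.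
  have [n [ws [Nn un wsp hws]]] := rx u (size u + N)%N.
  have wn w : w \in ws -> size w = n by move=> /hws[].
  have An : A * expR (- s * (n - size u)%:R) <= expR (- t * (n - size u)%:R).
    rewrite -[X in X * _]lnK ?posrE ?(lt_le_trans _ A_ge1) // -expRD ler_expR.
    rewrite -lerBrDr -mulrBl opprK addrC -ler_pdivrMl ?subr_gt0 // mulrC.
    have : (N%:R : R) <= (n - size u)%:R by rewrite ler_nat leq_subRL.
    apply: le_trans; rewrite ltW // -truncn_lt_nat //.
    by rewrite divr_ge0 ?subr_ge0 ?ln_ge0 // ltW.
  have [w wws Fw] := exists_child s n u ws (ltW ts) wsp wn un An Fu.
  exists (exist _ w Fw) => /=; have [sw [l [l1 ln xl]]] := hws w wws.
  rewrite sw; split.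
  - by apply: leq_trans Nn; rewrite -addn1 leq_add2l.
  - by case: wsp => _ + _; apply.
  - by exists l.
have [f hf] := choice next.
pose U k := iter k f (exist _ [::] F0).
have UkS k : (size (val (U k)) < size (val (U k.+1)))%N by case: (hf (U k)).
have Uk k : (k <= size (val (U k)))%N.
  by elim: k => // k IHk; exact: leq_ltn_trans IHk (UkS k).
have Utake j k : (j <= k)%N -> take (size (val (U j))) (val (U k)) = val (U j).
  move=> /subnKC <-; elim: (k - j)%N => [|i IHi].
    by rewrite addn0 take_size.
  have [_ tU _] := hf (U (j + i)%N).
  have sji : (size (val (U j)) <= size (val (U (j + i)%N)))%N.
    by rewrite -[in leqLHS]IHi size_take_min geq_minr.
  by rewrite addnS -[in RHS]IHi -[in RHS]tU take_takel.
(* Node [i.+1] has length greater than [i], so the default symbol is never read. *)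
pose y : Sigma2 := fun i => nth false (val (U i.+1)) i.
have yU k : prefix y (size (val (U k))) = val (U k).
  apply: (@eq_from_nth _ false); rewrite size_prefix // => i ik.
  rewrite nth_mkseq // /symbol_at /y.
  have [ki|ki] := leqP i.+1 k.
    by rewrite -(Utake _ _ ki) nth_take // Uk.
  by rewrite -(Utake _ _ (ltnW ki)) nth_take.
exists y; split.
  (* The node numbered [size (code w)] is long enough to decide whether the branch lies in the
     cylinder of [code w]. *)
  move=> w Gw yw; have := valP (U (size (code w))).
  rewrite ltNge => /negP; apply; apply: (total_cost_prefix _ w) => //.
  by rewrite -yU prefix_take.
move=> M; exists (size (val (U M.+1))).
have [_ _ [l [l1 ln xl]]] := hf (U M).
by exists l; split => //; [exact: ltnW|rewrite yU].
Qed.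
End Cost.

(** * Entropy of the set of well-approximated points *)

Lemma hitting_rate_le {R : realType} (c : R) (x y : Sigma2) :
  (forall M, exists n l, [/\ (M <= n)%N, (1 <= l)%N,
    l%:R <= expR (c * ln 2 * n%:R) &
    prefix (iter l shift_map x) n = prefix y n]) ->
  (hitting_rate x y <= c%:E)%E.
Proof.
move=> h; rewrite /hitting_rate limn_einf_lim; apply: lime_le.
  exact: is_cvg_einfs.
apply: nearW => M; apply: ge_ereal_inf.
(* Taking [M.+1] instead of [M] keeps [n] positive. *)
have [n [l [Mn l1 lgam xl]]] := h M.+1.
have n0 : 0 < n%:R :> R by rewrite ltr0n (leq_ltn_trans _ Mn).
have ln2 : 0 < ln (2 : R) by rewrite ln_gt0 // ltr1n.
eexists; first by exists n; [exact: ltnW|reflexivity].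
have tl : (hitting_time n x y <= (l%:R : R)%:E)%E.
  by apply: ereal_inf_lbound; exists l => //; split => //; rewrite cylinderE.
have t0 : (0 <= hitting_time n x y :> \bar R)%E.
  by apply: le_ereal_inf_tmp => _ [k _ <-]; rewrite lee_fin.
have l0 : 0 < l%:R :> R by rewrite ltr0n.
have lnt : (lne (hitting_time n x y) <= (c * ln 2 * n%:R)%:E :> \bar R)%E.
  apply: (@le_trans _ _ (lne (l%:R : R)%:E)).
    by rewrite lee_lne // in_itv /= ?t0 ?leey // lee_fin ltW.
  by rewrite lne_EFin // lee_fin -[leRHS]expRK ler_ln ?posrE ?expR_gt0.
apply: (@le_trans _ _ ((n%:R^-1)%:E * ((c * ln 2 * n%:R)%:E * ((ln 2)^-1)%:E))%E).
  apply: lee_wpmul2l; first by rewrite lee_fin invr_ge0 ltW.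
  by apply: lee_wpmul2r => //; rewrite lee_fin invr_ge0 ltW.
rewrite -!EFinM lee_fin le_eqVlt; apply/orP; left; apply/eqP.
by field; rewrite !gt_eqF.
Qed.

Section FirstSymbolCover.
Context {R : realType}.

(** Topological entropy is a supremum over open covers, so one cover bounds it below; for the
    partition by the first symbol the string sets are the cylinders. *)
Let U (j : 'I_2) : set Sigma2 := [set y | symbol_at y 0 = ((j : nat) == 1)%N].
Let code (w : seq 'I_2) : seq bool := [seq ((j : nat) == 1)%N | j : 'I_2 <- w].

Lemma string_set_prefix w y :
  string_set shift_map U w y <-> prefix y (size (code w)) = code w.
Proof.
elim: w y => [|j w IHw] y //=.
rewrite -[(size (code w)).+1]add1n prefix_cat /= /setI /= /preimage /=.
split; first by move=> [Uj /IHw e]; congr (_ :: _).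
by move=> [Uj e]; split => //; apply/IHw.
Qed.

(** For [t < s], a family of strings with sum below [1 / N], where [N] is at least [A], has total
    cost below 1 at the root. A branch then avoids it while lying in [Z], so the premeasures of
    exponent [t] cannot tend to 0. *)
Lemma entropy_hitting_ge (A s c : R) x : 1 <= A -> 0 < s ->
  rich A (s * ln 2) (c * ln 2) x ->
  (s%:E <= topological_entropy shift_map
    [set y : Sigma2 | (hitting_rate x y <= c%:E)%E])%E.
Proof.
move=> A1 s0 rx; set Z := [set y | _].
have ln2 : 0 < ln (2 : R) by rewrite ln_gt0 // ltr1n.
suff h : (s%:E <= entropy_of_cover shift_map U Z)%E.
  apply: (le_trans h); apply: ereal_sup_ubound; exists 2%N, U; split => //.
    by move=> j; exact: open_symbol.
  apply/seteqP; split => // y _; have [yb|yb] := boolP (symbol_at y 0).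
    by exists (@Ordinal 2 1 isT) => //; rewrite /U /= yb.
  by exists (@Ordinal 2 0 isT) => //; rewrite /U /= (negbTE yb).
apply: le_ereal_inf_tmp => _ [t [_ mt] <-]; rewrite lee_fin leNgt; apply/negP => ts.
pose N := (Num.trunc A).+1.
have AN : A <= N%:R.
  by rewrite ltW // -truncn_lt_nat // (le_trans _ A1).
have N0 : 0 < (N%:R)^-1 :> R by rewrite invr_gt0 ltr0n.
suff pre M : ((N%:R)^-1%:E <= cover_premeasure shift_map U Z t M)%E.
  have : ((N%:R)^-1%:E <= cover_measure shift_map U Z t)%E.
    apply: lime_ge; last exact: nearW.
    (* The limit exists because asking for longer strings leaves fewer covers, which raises the
       infimum. *)
    apply: ereal_nondecreasing_is_cvgn => m n mn.
    apply: le_ereal_inf_tmp => _ [G [Gn ZG] <-]; apply: ereal_inf_lbound.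
    by exists G => //; split => // w /Gn; exact: leq_trans.
  by rewrite mt lee_fin leNgt N0.
apply: le_ereal_inf_tmp => _ [G [_ ZG] <-]; rewrite leNgt; apply/negP => small.
have powE w : 2 `^ (- t * (size w)%:R) = expR (- (t * ln 2) * (size (code w))%:R) :> R.
  by rewrite /powR pnatr_eq0 /= size_map; congr expR; ring.
have F0 : (total_cost A (t * ln 2) _ G code [::] < 1)%E.
  (* [A] is rounded up to [N] copies of each term, a finite sum that can be exchanged with the sum
     over [G]. *)
  apply: (@le_lt_trans _ _ (\esum_(w in G)
      \sum_(i < N) (2 `^ (- t * (size w)%:R))%:E)%E).
    apply: le_esum => w _; rewrite sumEFin lee_fin sumr_const card_ord powE /cost.
    rewrite -[leRHS]mulr_natl; case: (code w) => [|b v] /=.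
      by rewrite mulr0 expR0 mulr1 (le_trans A1).
    by rewrite subn0 mulr1 ler_wpM2r ?expR_ge0.
  rewrite esum_sum; last by move=> *; rewrite lee_fin powR_ge0.
  set X := (\esum_(w in G) _)%E in small *.
  have X0 : (0 <= X)%E by apply: esum_ge0 => w _; rewrite lee_fin powR_ge0.
  have XE : X = (fine X)%:E.
    by rewrite fineK // ge0_fin_numE // (lt_trans small) // ltry.
  rewrite XE sumEFin lte_fin sumr_const card_ord -mulr_natr -ltr_pdivlMr ?ltr0n //.
  by rewrite mul1r -lte_fin -XE.
have ts' : t * ln 2 < s * ln 2 by rewrite ltr_pM2r.
have [y [yG hy]] := exists_branch _ _ A1 _ _ _ _ _ _ ts' rx F0.
have [w Gw /string_set_prefix] := ZG y (hitting_rate_le _ _ _ hy).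
exact: yG.
Qed.
End FirstSymbolCover.

(** * Approximation by cylinders *)

Definition symdiff {T : Type} (A B : set T) := (A `\` B) `|` (B `\` A).

Section Approximation.
Context {R : realType} (mu : probability Sigma2 R).
Implicit Types A B C : set Sigma2.

Lemma fine_measure_mono A B : measurable A -> measurable B -> A `<=` B ->
  fine (mu A) <= fine (mu B).
Proof.
move=> mA mB AB; rewrite fine_le ?fin_num_measure //.
by apply: le_measure; rewrite ?inE.
Qed.

Lemma fine_measureU A B : measurable A -> measurable B ->
  fine (mu (A `|` B)) <= fine (mu A) + fine (mu B).
Proof.
move=> mA mB; have mAB := measurableU _ _ mA mB.
rewrite -fineD ?fin_num_measure // fine_le ?fin_numD ?fin_num_measure //.
exact: measureU2.
Qed.

Lemma measurable_symdiff A B : measurable A -> measurable B ->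
  measurable (symdiff A B).
Proof. by move=> mA mB; apply: measurableU; exact: measurableD. Qed.

Let clop m (P : pred (seq bool)) := [set x : Sigma2 | P (prefix x m)].

Let measurable_clop m P : measurable (clop m P).
Proof. exact: (weight_prefix mu m P).1. Qed.

Definition approximable A := measurable A /\ forall e : R, 0 < e ->
  exists m P, fine (mu (symdiff A (clop m P))) < e.

Lemma approximable_clop m P : approximable (clop m P).
Proof.
split => // e e0; exists m, P; rewrite /symdiff !setDv setU0.
by rewrite measure0.
Qed.

Lemma approximable_close A : measurable A ->
  (forall e : R, 0 < e -> exists B, approximable B /\ fine (mu (symdiff A B)) < e) ->
  approximable A.
Proof.
move=> mA h; split => // e e0; have e2 : 0 < e / 2 by rewrite divr_gt0.
have [B [[mB aB] AB]] := h _ e2; have [m [P BP]] := aB _ e2; exists m, P.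
have m1 := measurable_symdiff _ _ mA mB.
have m2 := measurable_symdiff _ _ mB (measurable_clop m P).
apply: (@le_lt_trans _ _ (fine (mu (symdiff A B `|` symdiff B (clop m P))))).
  apply: fine_measure_mono.
  - exact: measurable_symdiff.
  - exact: measurableU.
  move=> x [[Ax Px]|[Px Ax]]; have [Bx|Bx] := pselect (B x).
  - by right; left.
  - by left; left.
  - by left; right.
  - by right; right.
by rewrite (le_lt_trans (fine_measureU _ _ m1 m2)) // (splitr e) ltrD.
Qed.

Lemma approximableU A B : approximable A -> approximable B -> approximable (A `|` B).
Proof.
move=> [mA aA] [mB aB]; apply: approximable_close; first exact: measurableU.
move=> e e0; have e2 : 0 < e / 2 by rewrite divr_gt0.
have [m [P AP]] := aA _ e2; have [m' [P' BP]] := aB _ e2.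
have cU : clop m P `|` clop m' P' =
    clop (maxn m m') (fun w => P (take m w) || P' (take m' w)).
  apply/seteqP; split => x; rewrite /clop /= !prefix_take ?leq_maxl ?leq_maxr //.
    by case=> ->; rewrite ?orbT.
  by move/orP.
exists (clop m P `|` clop m' P'); split; first by rewrite cU; exact: approximable_clop.
have m1 := measurable_symdiff _ _ mA (measurable_clop m P).
have m2 := measurable_symdiff _ _ mB (measurable_clop m' P').
apply: (@le_lt_trans _ _ (fine (mu (symdiff A (clop m P) `|` symdiff B (clop m' P'))))).
  apply: fine_measure_mono.
  - by apply: measurable_symdiff; exact: measurableU.
  - exact: measurableU.
  move=> x [[[Ax|Bx] /not_orP[Px P'x]]|[[Px|P'x] /not_orP[Ax Bx]]].
  - by left; left.
  - by right; left.
  - by left; right.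
  - by right; right.
by rewrite (le_lt_trans (fine_measureU _ _ m1 m2)) // (splitr e) ltrD.
Qed.

(** Continuity of [mu] from below reduces a countable union to a finite one. *)
Lemma approximable_bigcup (F : (set Sigma2)^nat) :
  (forall n, approximable (F n)) -> approximable (\bigcup_n F n).
Proof.
move=> aF; have mF n : measurable (F n) by case: (aF n).
pose B n := \big[setU/set0]_(i < n.+1) F i.
have aB n : approximable (B n).
  rewrite /B; elim: n => [|n IHn]; rewrite big_ord_recr /=.
    by rewrite big_ord0 set0U; exact: aF.
  by apply: approximableU; [exact: IHn|exact: aF].
have mB n : measurable (B n) by case: (aB n).
have mU : measurable (\bigcup_n F n) by exact: bigcupT_measurable.
apply: approximable_close => // e e0.
have BU : \bigcup_n B n = \bigcup_n F n by exact: bigcup_bigsetU_bigcup.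
have cvB : (mu \o B) n @[n --> \oo] --> mu (\bigcup_n F n).
  rewrite -BU; apply: nondecreasing_cvg_mu => //; first by rewrite BU.
  by move=> i j ij; rewrite subsetEset; apply: subset_bigsetU.
have lt_mu : ((fine (mu (\bigcup_n F n)) - e)%:E < mu (\bigcup_n F n))%E.
  by rewrite -[X in (_ < X)%E]fineK ?fin_num_measure // lte_fin ltrBlDr ltrDl.
have [n _ /(_ n (leqnn n)) /= Bn] := cvB _ (open_ereal_gt' lt_mu).
have BF : B n `<=` \bigcup_n F n by rewrite -BU => x Bx; exists n.
exists (B n); split => //; rewrite /symdiff [B n `\` _]setDE.
rewrite (_ : B n `&` _ = set0) ?setU0; last first.
  by apply/seteqP; split => x // -[/BF ?].
have -> : mu (\bigcup_n F n `\` B n) = (mu (\bigcup_n F n) - mu (B n))%E.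
  by rewrite measureD // ?(setIidr BF) // ltey_eq fin_num_measure.
rewrite fineB ?fin_num_measure //.
by move: Bn; rewrite -[X in (_ < X)%E]fineK ?fin_num_measure // lte_fin; lra.
Qed.

(** The approximable sets form a sigma-algebra, and an open set is the countable union of the
    cylinders it contains. *)
Lemma approximable_measurable A : measurable A -> approximable A.
Proof.
move: A; apply: (@smallest_sub _ (sigma_algebra setT) (@open cantor_space)).
  split.
  - have -> : set0 = clop 0 (fun=> false) by apply/seteqP; split => x.
    exact: approximable_clop.
  - move=> A [mA aA]; rewrite setTD; split; first exact: measurableC.
    move=> e e0; have [m [P AP]] := aA e e0; exists m, (predC P).
    suff -> : symdiff (~` A) (clop m (predC P)) = symdiff A (clop m P) by [].
    have -> : clop m (predC P) = ~` clop m P.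
      by apply/seteqP; split => x /= /negP.
    by rewrite /symdiff !setDE !setCK setUC [_ `&` A]setIC [~` A `&` _]setIC.
  - exact: approximable_bigcup.
move=> A oA.
have -> : A = \bigcup_n clop n (fun w => `[< [set x | prefix x (size w) = w] `<=` A >]).
  apply/seteqP; split => x; last by case=> n _ /asboolP; rewrite size_prefix; apply.
  move=> /(open_sub_prefix _ _ oA)[n hn]; exists n => //.
  by apply/asboolP; rewrite size_prefix.
by apply: approximable_bigcup => n; exact: approximable_clop.
Qed.

(** Each cell is approximated to within [e / k]. Off all the symmetric differences exactly one
    approximating set contains the point, so [f] recovers its cell there. *)
Lemma approximate_partition k (xi : Sigma2 -> 'I_k) (e : R) :
  (forall j, measurable (xi @^-1` [set j])) -> 0 < e ->
  exists m (f : seq bool -> 'I_k),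
    measurable [set x | xi x != f (prefix x m)] /\
    fine (mu [set x | xi x != f (prefix x m)]) <= e.
Proof.
move=> mxi e0; have k0 : (0 < k)%N by case: k xi mxi => // xi; case: (xi point).
have ek : 0 < e / k%:R by rewrite divr_gt0 // ltr0n.
have /choice[mP hmP] : forall j, exists mP : nat * pred (seq bool),
    fine (mu (symdiff (xi @^-1` [set j]) (clop mP.1 mP.2))) < e / k%:R.
  move=> j; have [_ /(_ _ ek)[m [P h]]] := approximable_measurable _ (mxi j).
  by exists (m, P).
pose m := \max_j (mP j).1.
have le_m j : ((mP j).1 <= m)%N by exact: leq_bigmax.
(* The default [xi point] is returned only for words in no approximating set, where a cell has been
   missed anyway. *)
pose f w := odflt (xi point) [pick j | (mP j).2 (take (mP j).1 w)].
pose D j := symdiff (xi @^-1` [set j]) (clop (mP j).1 (mP j).2).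
have mD j : measurable (D j) by exact: measurable_symdiff.
have mE : measurable [set x | xi x != f (prefix x m)].
  have := (fine_measure_fibers mu _ (fun x => (xi x, prefix x m)) _
    [seq (j, w) | j <- enum 'I_k, w <- words m] (fun jw => jw.1 != f jw.2) _ _).1.
  apply.
  - move=> [j w]; rewrite (_ : _ @^-1` _ = xi @^-1` [set j] `&` [set x | prefix x m = w]).
      by apply: measurableI => //; exact: measurable_prefix.
    by apply/seteqP; split => x /= [-> ->].
  - by rewrite allpairs_uniq ?enum_uniq ?words_uniq // => -[? ?] [? ?] _ _ [-> ->].
  - by move=> x; rewrite allpairs_f ?mem_enum // mem_words size_prefix.
exists m, f; split => //.
have sub : [set x | xi x != f (prefix x m)] `<=` [set x | exists2 j, j \in enum 'I_k & D j x].
  move=> x; apply: contraPP => /forall2NP h /=; apply/negP; rewrite negbK.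
  have {}h j : (mP j).2 (prefix x (mP j).1) = (xi x == j).
    have [|] := h j; first by rewrite mem_enum.
    move=> /not_orP[/not_andP h1 /not_andP h2]; apply/idP/eqP.
      by move=> Pj; case: h2 => // /contrapT.
    by move=> xj; case: h1 => // /contrapT.
  rewrite /f; case: pickP => [j|/(_ (xi x))].
    by rewrite prefix_take // h.
  by rewrite prefix_take // h eqxx.
have mDs (s : seq 'I_k) : measurable [set x | exists2 j, j \in s & D j x] /\
    fine (mu [set x | exists2 j, j \in s & D j x]) <= \sum_(j <- s) (e / k%:R).
  elim: s => [|j s [ms IHs]].
    rewrite (_ : [set x | _] = set0); last by apply/seteqP; split => x // -[].
    by rewrite measure0 big_nil.
  have -> : [set x | exists2 i, i \in j :: s & D i x] =
      D j `|` [set x | exists2 i, i \in s & D i x].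
    apply/seteqP; split => x.
      move=> [i]; rewrite inE => /orP[/eqP -> ?|? ?]; first by left.
      by right; exists i.
    case=> [?|[i ? ?]]; first by exists j => //; rewrite inE eqxx.
    by exists i => //; rewrite inE; apply/orP; right.
  split; first exact: measurableU.
  rewrite big_cons (le_trans (fine_measureU _ _ (mD j) ms)) // lerD //.
  exact/ltW/hmP.
have [ms hs] := mDs (enum 'I_k).
rewrite (le_trans (fine_measure_mono _ _ mE ms sub)) // (le_trans hs) //.
rewrite big_const_seq count_predT iter_addr_0 -cardE card_ord -[leLHS]mulr_natr.
by rewrite divfK // pnatr_eq0 -lt0n.
Qed.
End Approximation.

(** * Entropy of a partition and of words *)

Section KolmogorovSinai.
Context {R : realType} (mu : probability Sigma2 R).
Hypothesis inv : shift_invariant mu.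
Hypothesis weight_gt0 : forall w, 0 < weight mu w.

Lemma measure_iter_shift i (A : set Sigma2) : measurable A ->
  mu (iter i shift_map @^-1` A) = mu A.
Proof.
elim: i A => [|i IHi] A mA //.
have -> : iter i.+1 shift_map @^-1` A = iter i shift_map @^-1` (shift_map @^-1` A) by [].
have mA' : measurable (shift_map @^-1` A).
  by rewrite -[X in measurable X]setTI; exact: measurable_shift.
by rewrite IHi // inv.
Qed.

Lemma sum_fibers_comp (X Y : eqType) (g : Sigma2 -> X) (h : X -> Y) (s : seq X)
    (ys : seq Y) (a : Y -> R) :
  (forall i, measurable (g @^-1` [set i])) -> uniq s -> (forall x, g x \in s) ->
  uniq ys -> (forall i, i \in s -> h i \in ys) ->
  \sum_(y <- ys) fine (mu [set x | h (g x) = y]) * a y =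
  \sum_(i <- s) fine (mu (g @^-1` [set i])) * a (h i).
Proof.
move=> mg us gs uys hys.
transitivity (\sum_(y <- ys) \sum_(i <- s)
    fine (mu (g @^-1` [set i])) * (h i == y)%:R * a y).
  apply: eq_bigr => y _; rewrite -mulr_suml; congr (_ * _).
  rewrite -(fine_measure_fibers mu _ g mg s (fun i => h i == y) us gs).2.
  by congr (fine (mu _)); apply/seteqP; split => x /= /eqP.
rewrite exchange_big /=; apply: eq_big_seq => i /hys hi.
rewrite (bigD1_seq (h i)) //= eqxx mulr1 big1 ?addr0 // => y.
by rewrite eq_sym => /negbTE ->; rewrite mulr0 mul0r.
Qed.

Section Fano.
Variables (n m k : nat) (xi : Sigma2 -> 'I_k) (f : seq bool -> 'I_k) (del : R).
Hypothesis mxi : forall j, measurable (xi @^-1` [set j]).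
Hypotheses (del_gt0 : 0 < del) (del_lt1 : del < 1).

Let itinerary x : {ffun 'I_n -> 'I_k} := [ffun i : 'I_n => xi (iter i shift_map x)].
Let g x := (itinerary x, prefix x (n + m)).
Let cells := [seq (w, u) | w <- enum {ffun 'I_n -> 'I_k}, u <- words (n + m)].
Let P c := fine (mu (g @^-1` [set c])).
Let cell_mass w := fine (mu (@join_cell _ Sigma2 shift_map k xi n w)).
Let predicted (i : 'I_n) (u : seq bool) := f (take m (drop i u)).

Let k_gt0 : (0 < k)%N.
Proof. by case: k xi => // xi'; case: (xi' point). Qed.

Let join_cellE w : @join_cell _ Sigma2 shift_map k xi n w = [set x | itinerary x = w].
Proof.
apply/seteqP; split => x /= h; last by move=> i; rewrite -h ffunE.
by apply/ffunP => i; rewrite ffunE h.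
Qed.

Let measurable_itinerary w : measurable [set x | itinerary x = w].
Proof.
rewrite -join_cellE.
have -> : @join_cell _ Sigma2 shift_map k xi n w =
   \bigcap_(i in [set: 'I_n]) (iter i shift_map @^-1` (xi @^-1` [set w i])).
  by apply/seteqP; split => x h i; [move=> _; exact: h|exact: h].
apply: fin_bigcap_measurable => [|i _]; first exact: finite_finset.
by rewrite -[X in measurable X]setTI; exact: measurable_iter_shift.
Qed.

Let measurable_g c : measurable (g @^-1` [set c]).
Proof.
case: c => w u.
rewrite (_ : _ @^-1` _ = [set x | itinerary x = w] `&` [set x | prefix x (n + m) = u]).
  by apply: measurableI => //; exact: measurable_prefix.
by apply/seteqP; split => x /pair_equal_spec.
Qed.

Let uniq_cells : uniq cells.
Proof.
by rewrite allpairs_uniq ?enum_uniq ?words_uniq // => -[? ?] [? ?] _ _ [-> ->].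
Qed.

Let mem_cells x : g x \in cells.
Proof. by rewrite allpairs_f ?mem_enum // mem_words size_prefix. Qed.

Let P_ge0 c : 0 <= P c. Proof. exact/fine_ge0/measure_ge0. Qed.

Let sum_P : \sum_(c <- cells) P c = 1.
Proof.
have [_] := fine_measure_fibers mu _ g measurable_g cells predT uniq_cells mem_cells.
rewrite (_ : [set x | _] = setT); last by apply/seteqP.
by rewrite probability_setT /= => ->; apply: eq_bigr => c _; rewrite mulr1.
Qed.

Let sum_itinerary a :
  \sum_(w : {ffun 'I_n -> 'I_k}) cell_mass w * a w = \sum_(c <- cells) P c * a c.1.
Proof.
rewrite -(sum_fibers_comp _ _ g fst cells (enum {ffun 'I_n -> 'I_k}) a
  measurable_g uniq_cells mem_cells (enum_uniq _)).
  by rewrite big_enum; apply: eq_bigr => w _; rewrite /cell_mass join_cellE.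
by move=> *; rewrite mem_enum.
Qed.

Let sum_prefix a :
  \sum_(u <- words (n + m)) weight mu u * a u = \sum_(c <- cells) P c * a c.2.
Proof.
rewrite -(sum_fibers_comp _ _ g snd cells (words (n + m)) a
  measurable_g uniq_cells mem_cells (words_uniq _)).
  by apply: eq_big_words => u su; rewrite /weight su.
by move=> _ /allpairsP[[w u] [_ ? ->]].
Qed.

(* The channel predicting the cell of [xi] from the approximation [f]: it errs
   with probability about [del]. *)
Let Q (u : seq bool) (i : 'I_n) (j : 'I_k) : R :=
  if j == predicted i u then 1 - del else del / k%:R.

Let Q_gt0 u i j : 0 < Q u i j.
Proof. by rewrite /Q; case: ifP; rewrite ?subr_gt0 // divr_gt0 // ltr0n. Qed.

Let sum_Q_le u i : \sum_j Q u i j <= 1.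
Proof.
rewrite (bigD1 (predicted i u)) //= /Q eqxx.
apply: (@le_trans _ _ (1 - del + \sum_(j < k) del / k%:R)); last first.
  by rewrite sumr_const card_ord -[_ *+ _]mulr_natr divfK ?subrK // pnatr_eq0 -lt0n.
rewrite lerD2l [leRHS](bigD1 (predicted i u)) //= -[leLHS]add0r lerD //.
  by rewrite divr_ge0 // ltW.
by apply: ler_sum => j /negbTE ->.
Qed.

(** The joint law of itinerary and word if, given the word, the channel drew the symbols
    independently; its total mass is at most 1. *)
Let rho (c : {ffun 'I_n -> 'I_k} * seq bool) : R := weight mu c.2 * \prod_(i < n) Q c.2 i (c.1 i).

Let prod_Q_gt0 (c : {ffun 'I_n -> 'I_k} * seq bool) : 0 < \prod_(i < n) Q c.2 i (c.1 i).
Proof. by apply: prodr_gt0 => i _. Qed.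

Let rho_gt0 (c : {ffun 'I_n -> 'I_k} * seq bool) : 0 < rho c. Proof. by rewrite mulr_gt0. Qed.

Let sum_rho_le : \sum_(c <- cells) rho c <= 1.
Proof.
rewrite big_allpairs exchange_big /=.
apply: (@le_trans _ _ (\sum_(u <- words (n + m)) weight mu u * 1)); last first.
  by rewrite (sum_prefix (fun=> 1)); under eq_bigr do rewrite mulr1; rewrite sum_P.
apply: ler_sum => u _; rewrite /rho /= -mulr_sumr.
rewrite ler_wpM2l ?(ltW (weight_gt0 _)) //.
rewrite big_enum /= -bigA_distr_bigA.
by apply: prodr_ile1 => i _; rewrite sum_Q_le sumr_ge0 // => j _; exact: ltW.
Qed.

Let P_le (c : {ffun 'I_n -> 'I_k} * seq bool) : P c <= cell_mass c.1.
Proof.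
apply: fine_measure_mono; first exact: measurable_g.
  by rewrite join_cellE; exact: measurable_itinerary.
by rewrite join_cellE => x <-.
Qed.

Let ln_rho (c : {ffun 'I_n -> 'I_k} * seq bool) :
  ln (rho c) = ln (weight mu c.2) + \sum_(i < n) ln (Q c.2 i (c.1 i)).
Proof.
rewrite lnM ?posrE //; congr (_ + _).
apply: proj2; apply: (big_rec2 (fun x y => 0 < x /\ ln x = y)).
  by rewrite ln1.
by move=> i y x _ [x0 <-]; rewrite mulr_gt0 // lnM ?posrE.
Qed.

(** Apply [ln z <= z - 1] to [z = rho c / cell_mass c.1]; since [P c <= cell_mass c.1], each
    difference is at most [rho c - P c], and these sum to at most 0. *)
Let gibbs_inequality :
  \sum_(c <- cells) P c * ln (rho c) <= \sum_(c <- cells) P c * ln (cell_mass c.1).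
Proof.
rewrite -subr_le0 -sumrB.
apply: (@le_trans _ _ (\sum_(c <- cells) (rho c - P c))); last first.
  by rewrite sumrB sum_P subr_le0.
apply: ler_sum => c _; have := P_ge0 c; rewrite le_eqVlt => /orP[/eqP <-|Pc0].
  by rewrite !mul0r !subr0 ltW.
have M0 : 0 < cell_mass c.1 by rewrite (lt_le_trans Pc0).
rewrite -mulrBr -ln_div ?posrE //.
have : ln (rho c / cell_mass c.1) <= rho c / cell_mass c.1 - 1.
  rewrite -{1}[rho c / _](subrK 1) addrC le_ln1Dx //.
  by rewrite ltrBrDl subrr divr_gt0.
move=> /(ler_wpM2l (ltW Pc0)) /le_trans; apply.
rewrite mulrBr mulr1 lerD2r mulrCA ler_piMr ?(ltW (rho_gt0 _)) //.
by rewrite ler_pdivrMr // mul1r.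
Qed.

(** Itineraries are encoded through the word: each symbol costs [- ln (1 - del)], plus at most
    [ln (k / del)] when mispredicted. The [m] extra letters let the prediction at every time below
    [n] see its whole window. *)
Lemma fano_entropy e :
  measurable [set x | xi x != f (prefix x m)] ->
  fine (mu [set x | xi x != f (prefix x m)]) <= e ->
  - \sum_(w : {ffun 'I_n -> 'I_k}) cell_mass w * ln (cell_mass w) <=
  - \sum_(u <- words (n + m)) weight mu u * ln (weight mu u) +
  n%:R * (- ln (1 - del) + ln (k%:R / del) * e).
Proof.
move=> mE hE; have kdel : 1 <= k%:R / del.
  by rewrite ler_pdivlMr // mul1r (le_trans (ltW del_lt1)) // ler1n.
have lnQ u i j : - ln (Q u i j) <=
    - ln (1 - del) + ln (k%:R / del) * (j != predicted i u)%:R.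
  rewrite /Q; case: eqP => /= _; first by rewrite mulr0 addr0.
  rewrite mulr1 -(invf_div k%:R) lnV ?posrE ?divr_gt0 ?ltr0n // opprK lerDr.
  by rewrite oppr_ge0 ln_le0 // gerBl ltW.
rewrite (sum_itinerary (fun w => ln (cell_mass w))) (sum_prefix (fun u => ln (weight mu u))).
have := gibbs_inequality; rewrite -lerN2 => /le_trans; apply.
rewrite -lerBlDl opprK addrC -sumrB.
have -> : \sum_(c <- cells) (P c * ln (weight mu c.2) - P c * ln (rho c)) =
    \sum_(i < n) \sum_(c <- cells) P c * - ln (Q c.2 i (c.1 i)).
  rewrite exchange_big /=; apply: eq_bigr => c _.
  by rewrite ln_rho -mulrBr opprD addNKr -mulr_sumr sumrN.
rewrite -[n%:R]/(n%:R) mulr_natl -[in leRHS](card_ord n) -sumr_const.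
apply: ler_sum => i _.
apply: (@le_trans _ _ (\sum_(c <- cells) (- ln (1 - del) * P c +
    ln (k%:R / del) * (P c * (c.1 i != predicted i c.2)%:R)))).
  apply: ler_sum => c _; rewrite (le_trans (ler_wpM2l (P_ge0 c) (lnQ _ _ _))) //.
  by rewrite le_eqVlt; apply/orP; left; apply/eqP; ring.
rewrite big_split /= -!mulr_sumr sum_P mulr1 lerD2l ler_wpM2l ?ln_ge0 //.
have [_ <-] := fine_measure_fibers mu _ g measurable_g cells
  (fun c => c.1 i != predicted i c.2) uniq_cells mem_cells.
(* By invariance, a misprediction at time [i] is as likely as one at time 0. *)
rewrite (le_trans _ hE) // -(measure_iter_shift i _ mE).
rewrite le_eqVlt; apply/orP; left; apply/eqP; congr (fine (mu _)).
apply/seteqP; split => x /=; rewrite ffunE /predicted;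
  rewrite -[(n + m)%N](subnKC (leq_trans (ltnW (ltn_ord i)) (leq_addr m n)));
  rewrite prefix_drop prefix_take // -addnBAC ?leq_addl //; exact: ltnW.
Qed.
End Fano.

(** Some partition has entropy rate above [c]. Predicting it well from cylinders passes this rate to
    words, up to a loss per letter smaller than the margin, and a large length absorbs any constant
    [C0]. *)
Lemma exists_entropy_gap (c C0 : R) : 0 < c ->
  (c%:E < metric_entropy mu shift_map)%E ->
  exists2 r, (0 < r)%N &
    \sum_(b <- words r) weight mu b * ln (weight mu b) + C0 + c * ln 2 * r%:R < 0.
Proof.
move=> c0 /ereal_sup_gt[_ [k [xi [mxi ->]]] hc].
have ln2 : 0 < ln (2 : R) by rewrite ln_gt0 // ltr1n.
set h := (fun n => (partition_entropy mu (@join_cell _ _ shift_map k xi n) / n%:R)%:E) in hc.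
(* A divergent sequence would get the default limit 0, which does not exceed [c]. *)
have cvh : cvgn h.
  apply: contrapT => /dvgP hE; move: hc.
  by rewrite /metric_entropy_of -/h hE lte_fin ltNge (ltW c0).
have [c1 cc1 c1h] : exists2 c1 : R, c < c1 & (c1%:E < limn h)%E.
  move: hc; rewrite /metric_entropy_of -/h; case: (limn h) => [l|_|//].
    rewrite lte_fin => cl; exists ((c + l) / 2); first by rewrite midf_lt.
    by rewrite lte_fin midf_lt.
  by exists (c + 1); rewrite ?ltrDl // ltry.
(* Half of the margin [c1 - c], in natural units, pays for the prediction loss, the other half for
   [C0] and the [m] extra letters. *)
pose eta := (c1 - c) * ln 2 / 2.
have eta0 : 0 < eta by rewrite divr_gt0 // mulr_gt0 // subr_gt0.
(* Chosen so that [- ln (1 - del) = eta / 2]; the error [e] below keeps the cost of mispredictions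
   within the other [eta / 2]. *)
pose del : R := 1 - expR (- (eta / 2)).
have del_gt0 : 0 < del by rewrite subr_gt0 expR_lt1 oppr_lt0 divr_gt0.
have del_lt1 : del < 1 by rewrite gtrBl expR_gt0.
have k0 : (0 < k)%N by case: k xi mxi {h hc cvh c1h} => // xi'; case: (xi' point).
have kdel : 0 <= ln (k%:R / del).
  by rewrite ln_ge0 // ler_pdivlMr // mul1r (le_trans (ltW del_lt1)) // ler1n.
pose e := eta / 2 / (1 + ln (k%:R / del)).
have d0 : 0 < 1 + ln (k%:R / del) by rewrite ltr_pwDl.
have e0 : 0 < e by apply: divr_gt0 => //; exact: divr_gt0.
have [m [f [mE hE]]] := approximate_partition mu _ _ _ mxi e0.
have fano n := fano_entropy n m k xi f del mxi del_gt0 del_lt1 e mE hE.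
have eta2 : 0 <= eta / 2 by rewrite ltW // divr_gt0.
have he : - ln (1 - del) + ln (k%:R / del) * e <= eta.
  have -> : ln (1 - del) = - (eta / 2) by rewrite /del opprB addrC subrK expRK.
  rewrite opprK [leRHS](splitr eta) lerD2l /e mulrCA ler_piMr //.
  by rewrite ler_pdivrMr // mul1r lerDr.
have [N _ hN] := cvh _ (open_ereal_gt' c1h).
pose n := maxn N (Num.trunc (Num.max 0 (C0 + c * ln 2 * m%:R) / eta)).+1.
have n_gt0 : (0 < n)%N by rewrite leq_max orbT.
have n0 : 0 < n%:R :> R by rewrite ltr0n.
have hn : C0 + c * ln 2 * m%:R < eta * n%:R.
  have h0 : 0 <= Num.max 0 (C0 + c * ln 2 * m%:R) / eta.
    by apply: divr_ge0; [rewrite le_max lexx|exact: ltW].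
  apply: (@le_lt_trans _ _ (Num.max 0 (C0 + c * ln 2 * m%:R))).
    by rewrite le_max lexx orbT.
  by rewrite -ltr_pdivrMl // mulrC -truncn_lt_nat // leq_max leqnn orbT.
exists (n + m)%N; first by rewrite addn_gt0 n_gt0.
have := hN n (leq_maxl _ _); rewrite /= lte_fin /partition_entropy ltr_pdivlMr //.
rewrite [X in - X](_ : _ = (\sum_w fine (mu (@join_cell _ Sigma2 shift_map k xi n w)) *
    ln (fine (mu (join_cell shift_map xi w)))) / ln 2); last first.
  by rewrite mulr_suml; apply: eq_bigr => w _; rewrite /log2 mulrA.
rewrite -mulNr ltr_pdivlMr // => hpart.
have hf := lt_le_trans hpart (fano n).
have hne := ler_wpM2l (ltW n0) he.
rewrite natrD.
have etaE : (c1 - c) * ln 2 = eta + eta by rewrite -splitr.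
have := congr1 (fun z => z * n%:R) etaE.
move: hf hne hn; set H := \sum_(u <- _) _; lra.
Qed.
End KolmogorovSinai.

Theorem theorem7p9 (R : realType) (phi : Sigma2 -> R)
    (mu : probability Sigma2 R) (c : R)
    (hphi : holder phi) (hmu : gibbs_measure phi mu)
    (hc0 : 0 < c) (hc : (c%:E < metric_entropy mu shift_map)%E) :
  {ae mu, forall x : Sigma2,
    (c%:E <= topological_entropy shift_map
               [set y : Sigma2 | (hitting_rate x y <= c%:E)%E])%E}.
Proof.
have inv := hmu.1; have [K qb] := gibbs_quasi_bernoulli _ _ hmu.
have ln2 : 0 < ln (2 : R) by rewrite ln_gt0 // ltr1n.
(* With [C0 = ln K], [gap] says that the function [psi] of the maximal inequality has negative
   mean. *)
have [r r0 gap] := exists_entropy_gap mu inv (qb_gt0 _ _ qb) c (ln K) hc0 hc.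
have gam0 : 0 < c * ln 2 by rewrite mulr_gt0.
have [|D [del [D0 del0 steady_ge]]] := steady_mass _ _ qb r (c * ln 2) r0 gam0.
  under eq_bigr do rewrite !mulrDr.
  by rewrite !big_split /= -!mulr_suml (qb_sum _ _ qb) !mul1r.
(* The Frostman exponent must stay strictly below [c]; a sequence tending to [c] leaves only
   countably many null sets to discard. *)
pose s j := c - c / j.+2%:R.
have s_gt0 j : 0 < s j.
  by rewrite subr_gt0 ltr_pdivrMr ?ltr0n // ltr_pMr // ltr1n.
have s_lt j : s j < c by rewrite gtrBl divr_gt0 // ltr0n.
have ae_s j : {ae mu, forall x : Sigma2, ((s j)%:E <= topological_entropy shift_map
    [set y : Sigma2 | (hitting_rate x y <= c%:E)%E])%E}.
  have sj0 : 0 < s j * ln 2 by rewrite mulr_gt0.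
  have sjc : s j * ln 2 < c * ln 2 by rewrite ltr_pM2r.
  have [A A1] := ae_rich mu K qb D (c * ln 2) del (s j * ln 2) D0 del0 sj0 sjc steady_ge.
  by apply: filterS => x; exact: entropy_hitting_ge.
have := ae_foralln ae_s; apply: filterS => x h.
apply/lee_addgt0Pr => e e0.
pose j := Num.trunc (c / e).
have je : c / j.+2%:R <= e.
  rewrite ler_pdivrMr ?ltr0n // mulrC -ler_pdivrMr // ltW //.
  by rewrite -truncn_lt_nat // divr_ge0 // ltW.
apply: (@le_trans _ _ ((s j)%:E + e%:E)%E); last exact: leeD2r.
by rewrite -EFinD lee_fin /s -addrA lerDl [leRHS]addrC subr_ge0.
Qed.
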